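(* Let $k$ be a field of characteristic $0$ and let $k\{z_1,z_2,\ldots,z_m\}$ be the free Poisson algebra over $k$ in the variables $z_1,z_2,\ldots,z_m$. If $f\in k\{z_1,z_2,\ldots,z_m\}$ and $f\notin k\{z_1,z_2,\ldots,z_{m-1}\}$, then $(f)\cap k\{z_1,z_2,\ldots,z_{m-1}\}=0$.
   Context: A Poisson algebra over a field $k$ is a $k$-vector space $B$ with two bilinear operations $x\cdot y$ and $\{x,y\}$ such that $B$ is a commutative associative (unital) algebra under $x\cdot y$, a Lie algebra under $\{x,y\}$, and the Leibniz identity $\{x,y\cdot z\}=\{x,y\}\cdot z+y\cdot\{x,z\}$ holds. For a Lie algebra $\mathfrak g$ with linear basis $e_1,e_2,\ldots$, the symmetric Poisson algebra $PS(\mathfrak g)$ is the polynomial algebra $k[e_1,e_2,\ldots]$ with the Poisson bracket determined by $\{e_i,e_j\}=[e_i,e_j]$. The free Poisson algebra $k\{z_1,\ldots,z_m\}$ is $PS(\mathfrak g)$, where $\mathfrak g$ is the free Lie algebra on $z_1,\ldots,z_m$. The algebra $k\{z_1,\ldots,z_{m-1}\}$ is regarded as the Poisson subalgebra of $k\{z_1,\ldots,z_m\}$ generated by $z_1,\ldots,z_{m-1}$. $(f)$ denotes the ideal of the Poisson algebra $k\{z_1,\ldots,z_m\}$ generated by $f$, i.e. the smallest subspace containing $f$ that is closed under both multiplication by, and Poisson bracket with, arbitrary elements of the algebra. *)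

(* Defs.v *)
From HB Require Import structures.
From mathcomp Require Import all_boot all_order all_algebra ring.
From mathcomp Require Import generic_quotient boolp classical_sets.
From mathcomp Require Import finmap monalg.

Set Implicit Arguments.
Unset Strict Implicit.
Unset Printing Implicit Defensive.

Import GRing.Theory.

Local Open Scope ring_scope.
Local Open Scope quotient_scope.

(** * Lie algebras and Poisson algebras *)

HB.mixin Record Lmodule_isLie (k : fieldType) L of GRing.Lmodule k L := {
  lieb : L -> L -> L;
  lieb_linearl : forall a x y z, lieb (a *: x + y) z = a *: lieb x z + lieb y z;
  lieb_linearr : forall a x y z, lieb z (a *: x + y) = a *: lieb z x + lieb z y;
  liebxx : forall x, lieb x x = 0;
  lieb_jacobi : forall x y z,
    lieb x (lieb y z) + lieb y (lieb z x) + lieb z (lieb x y) = 0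
}.

#[short(type="lieAlgType")]
HB.structure Definition LieAlgebra (k : fieldType) :=
  { L of GRing.Lmodule k L & Lmodule_isLie k L }.

HB.mixin Record LieComAlgebra_isPoisson (k : fieldType) B
    of LieAlgebra k B & GRing.ComAlgebra k B := {
  lieb_leibniz : forall x y z : B,
    lieb x (y * z) = lieb x y * z + y * lieb x z
}.

#[short(type="poissonAlgType")]
HB.structure Definition PoissonAlgebra (k : fieldType) :=
  { B of GRing.ComAlgebra k B & LieAlgebra k B & LieComAlgebra_isPoisson k B }.

Record poisson_subalgebra (k : fieldType) (B : poissonAlgType k) (S : set B) :
    Prop := PoissonSubalgebra {
  psub_1 : S 1;
  psub_linear : forall (a : k) (x y : B), S x -> S y -> S (a *: x + y);
  psub_mul : forall x y : B, S x -> S y -> S (x * y);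
  psub_lieb : forall x y : B, S x -> S y -> S (lieb x y)
}.

Record poisson_ideal (k : fieldType) (B : poissonAlgType k) (J : set B) :
    Prop := PoissonIdeal {
  pideal_0 : J 0;
  pideal_linear : forall (a : k) (x y : B), J x -> J y -> J (a *: x + y);
  pideal_mul : forall x y : B, J y -> J (x * y);
  pideal_lieb : forall x y : B, J y -> J (lieb x y)
}.

Definition subalgebra_gen (k : fieldType) (B : poissonAlgType k) (S : set B) :
  set B := smallest (@poisson_subalgebra k B) S.

Definition ideal_gen (k : fieldType) (B : poissonAlgType k) (f : B) :
  set B := smallest (@poisson_ideal k B) [set f].

(** * The free Lie algebra on [X]: formal Lie expressions in the letters of
    [X], modulo the congruence generated by the axioms of Lie algebras *)

Section FreeLie.
Variables (k : fieldType) (X : Type).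

Inductive lie_term : Type :=
  | LVar of X
  | LZero
  | LAdd of lie_term & lie_term
  | LScale of k & lie_term
  | LBr of lie_term & lie_term.

Inductive lie_cong : lie_term -> lie_term -> Prop :=
  | lc_refl t : lie_cong t t
  | lc_sym t u : lie_cong t u -> lie_cong u t
  | lc_trans t u v : lie_cong t u -> lie_cong u v -> lie_cong t v
  | lc_add t t' u u' :
      lie_cong t t' -> lie_cong u u' -> lie_cong (LAdd t u) (LAdd t' u')
  | lc_scale a t t' : lie_cong t t' -> lie_cong (LScale a t) (LScale a t')
  | lc_br t t' u u' :
      lie_cong t t' -> lie_cong u u' -> lie_cong (LBr t u) (LBr t' u')
  | lc_addA t u v : lie_cong (LAdd t (LAdd u v)) (LAdd (LAdd t u) v)
  | lc_addC t u : lie_cong (LAdd t u) (LAdd u t)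
  | lc_add0 t : lie_cong (LAdd LZero t) t
  | lc_addN t : lie_cong (LAdd (LScale (-1) t) t) LZero
  | lc_scaleA a b t : lie_cong (LScale a (LScale b t)) (LScale (a * b) t)
  | lc_scale1 t : lie_cong (LScale 1 t) t
  | lc_scaleDr a t u :
      lie_cong (LScale a (LAdd t u)) (LAdd (LScale a t) (LScale a u))
  | lc_scaleDl t a b :
      lie_cong (LScale (a + b) t) (LAdd (LScale a t) (LScale b t))
  | lc_brl a t u v :
      lie_cong (LBr (LAdd (LScale a t) u) v)
               (LAdd (LScale a (LBr t v)) (LBr u v))
  | lc_brr a t u v :
      lie_cong (LBr v (LAdd (LScale a t) u))
               (LAdd (LScale a (LBr v t)) (LBr v u))
  | lc_brtt t : lie_cong (LBr t t) LZero
  | lc_jacobi t u v :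
      lie_cong
        (LAdd (LAdd (LBr t (LBr u v)) (LBr u (LBr v t))) (LBr v (LBr t u)))
        LZero.

HB.instance Definition _ := gen_eqMixin lie_term.
HB.instance Definition _ := gen_choiceMixin lie_term.

Definition lie_congb : rel lie_term := fun t u => `[< lie_cong t u >].

Lemma lie_congb_refl : reflexive lie_congb.
Proof. by move=> t; apply/asboolP/lc_refl. Qed.

Lemma lie_congb_sym : symmetric lie_congb.
Proof. by move=> t u; apply/asboolP/asboolP => /lc_sym. Qed.

Lemma lie_congb_trans : transitive lie_congb.
Proof.
by move=> u t v /asboolP tu /asboolP uv; apply/asboolP/(lc_trans tu uv).
Qed.

Canonical lie_cong_equiv :=
  EquivRel lie_congb lie_congb_refl lie_congb_sym lie_congb_trans.

Definition free_lie : Type := {eq_quot lie_cong_equiv}.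
HB.instance Definition _ := Choice.on free_lie.

Local Notation cls t := (\pi_({eq_quot lie_cong_equiv}) t : free_lie).

Lemma cls_eqP t u : cls t = cls u <-> lie_cong t u.
Proof.
by split=> [/eqmodP/asboolP //|tu]; apply/eqmodP/asboolP.
Qed.

Definition fl_gen (x : X) : free_lie := cls (LVar x).
Definition fl_zero : free_lie := cls LZero.
Definition fl_add (x y : free_lie) : free_lie := cls (LAdd (repr x) (repr y)).
Definition fl_scale (a : k) (x : free_lie) : free_lie :=
  cls (LScale a (repr x)).
Definition fl_br (x y : free_lie) : free_lie := cls (LBr (repr x) (repr y)).

Lemma repr_cls t : lie_cong (repr (cls t)) t.
Proof. by apply/cls_eqP; rewrite reprK. Qed.

Lemma fl_addE t u : fl_add (cls t) (cls u) = cls (LAdd t u).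
Proof. by apply/cls_eqP/lc_add; apply: repr_cls. Qed.

Lemma fl_scaleE a t : fl_scale a (cls t) = cls (LScale a t).
Proof. by apply/cls_eqP/lc_scale; apply: repr_cls. Qed.

Lemma fl_brE t u : fl_br (cls t) (cls u) = cls (LBr t u).
Proof. by apply/cls_eqP/lc_br; apply: repr_cls. Qed.

Let flE := (fl_scaleE, fl_brE, fl_addE).

Lemma fl_clsP (x : free_lie) : exists t, x = cls t.
Proof. by exists (repr x); rewrite reprK. Qed.

Fact fl_addA : associative fl_add.
Proof.
move=> x y z.
have [[[t ->] [u ->]] [v ->]] := (fl_clsP x, fl_clsP y, fl_clsP z).
by rewrite !flE; apply/cls_eqP/lc_addA.
Qed.

Fact fl_addC : commutative fl_add.
Proof.
move=> x y; have [[t ->] [u ->]] := (fl_clsP x, fl_clsP y).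
by rewrite !flE; apply/cls_eqP/lc_addC.
Qed.

Fact fl_add0 : left_id fl_zero fl_add.
Proof.
by move=> x; have [t ->] := fl_clsP x; rewrite !flE; apply/cls_eqP/lc_add0.
Qed.

Fact fl_addN : left_inverse fl_zero (fl_scale (-1)) fl_add.
Proof.
by move=> x; have [t ->] := fl_clsP x; rewrite !flE; apply/cls_eqP/lc_addN.
Qed.

HB.instance Definition _ :=
  GRing.isZmodule.Build free_lie fl_addA fl_addC fl_add0 fl_addN.

Fact fl_scaleA a b x : fl_scale a (fl_scale b x) = fl_scale (a * b) x.
Proof. by have [t ->] := fl_clsP x; rewrite !flE; apply/cls_eqP/lc_scaleA. Qed.

Fact fl_scale1 : left_id 1 fl_scale.
Proof.
by move=> x; have [t ->] := fl_clsP x; rewrite !flE; apply/cls_eqP/lc_scale1.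
Qed.

Fact fl_scaleDr : right_distributive fl_scale +%R.
Proof.
move=> a x y; have [[t ->] [u ->]] := (fl_clsP x, fl_clsP y).
rewrite -[RHS]/(fl_add (fl_scale a _) (fl_scale a _)).
rewrite -[cls t + cls u]/(fl_add _ _).
by rewrite !flE; apply/cls_eqP/lc_scaleDr.
Qed.

Fact fl_scaleDl x : {morph fl_scale^~ x : a b / a + b}.
Proof.
move=> a b; have [t ->] := fl_clsP x.
rewrite /= -[RHS]/(fl_add (fl_scale a _) (fl_scale b _)) !fl_scaleE !fl_addE.
exact/cls_eqP/lc_scaleDl.
Qed.

HB.instance Definition _ := GRing.Zmodule_isLmodule.Build k free_lie
  fl_scaleA fl_scale1 fl_scaleDr fl_scaleDl.

Lemma fl_addrE t u : cls t + cls u = cls (LAdd t u). Proof. exact: fl_addE. Qed.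
Lemma fl_scalerE a t : a *: cls t = cls (LScale a t).
Proof. exact: fl_scaleE. Qed.

Fact fl_brl a x y z : fl_br (a *: x + y) z = a *: fl_br x z + fl_br y z.
Proof.
have [[[t ->] [u ->]] [v ->]] := (fl_clsP x, fl_clsP y, fl_clsP z).
rewrite fl_scalerE fl_addrE !fl_brE fl_scalerE fl_addrE.
exact/cls_eqP/lc_brl.
Qed.

Fact fl_brr a x y z : fl_br z (a *: x + y) = a *: fl_br z x + fl_br z y.
Proof.
have [[[t ->] [u ->]] [v ->]] := (fl_clsP x, fl_clsP y, fl_clsP z).
rewrite fl_scalerE fl_addrE !fl_brE fl_scalerE fl_addrE.
exact/cls_eqP/lc_brr.
Qed.

Fact fl_brxx x : fl_br x x = 0.
Proof. by have [t ->] := fl_clsP x; rewrite flE; apply/cls_eqP/lc_brtt. Qed.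

Fact fl_jacobi x y z :
  fl_br x (fl_br y z) + fl_br y (fl_br z x) + fl_br z (fl_br x y) = 0.
Proof.
have [[[t ->] [u ->]] [v ->]] := (fl_clsP x, fl_clsP y, fl_clsP z).
by rewrite !fl_brE !fl_addrE; apply/cls_eqP/lc_jacobi.
Qed.

HB.instance Definition _ :=
  Lmodule_isLie.Build k free_lie fl_brl fl_brr fl_brxx fl_jacobi.

Lemma free_lie_universal (L : lieAlgType k) (y : X -> L) :
  exists! phi : free_lie -> L,
    [/\ forall a u v, phi (a *: u + v) = a *: phi u + phi v,
        forall u v, phi (lieb u v) = lieb (phi u) (phi v)
      & forall x, phi (fl_gen x) = y x].
Proof.
pose ev := fix ev t : L := match t with
  | LVar x => y x
  | LZero => 0
  | LAdd t u => ev t + ev u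
  | LScale a t => a *: ev t
  | LBr t u => lieb (ev t) (ev u) end.
have evP t u : lie_cong t u -> ev t = ev u.
  elim=> //= {t u}.
  - by move=> t u v _ -> _ ->.
  - by move=> t t' u u' _ -> _ ->.
  - by move=> a t t' _ ->.
  - by move=> t t' u u' _ -> _ ->.
  - by move=> t u v; rewrite addrA.
  - by move=> t u; rewrite addrC.
  - by move=> t; rewrite add0r.
  - by move=> t; rewrite scaleN1r addNr.
  - by move=> a b t; rewrite scalerA.
  - by move=> t; rewrite scale1r.
  - by move=> a t u; rewrite scalerDr.
  - by move=> t a b; rewrite scalerDl.
  - by move=> a t u v; rewrite lieb_linearl.
  - by move=> a t u v; rewrite lieb_linearr.
  - by move=> t; rewrite liebxx.
  - by move=> t u v; rewrite lieb_jacobi.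
have evK t : ev (repr (cls t)) = ev t by apply/evP/repr_cls.
exists (fun u => ev (repr u)); split.
  split=> [a u v|u v|x]; last by rewrite evK.
  - have [[t ->] [s ->]] := (fl_clsP u, fl_clsP v).
    by rewrite fl_scalerE fl_addrE !evK.
  - have [[t ->] [s ->]] := (fl_clsP u, fl_clsP v).
    by rewrite -[lieb _ _]/(fl_br _ _) fl_brE !evK.
move=> phi [phiL phiB phiX]; apply/funext => u.
have phi0 : phi 0 = 0.
  by have := phiL (-1) 0 0; rewrite scaler0 addr0 scaleN1r addNr.
have [t ->] := fl_clsP u; rewrite evK; elim: t => /= {u}.
- by move=> x; rewrite -phiX.
- exact/esym/phi0.
- move=> t -> u ->; rewrite -fl_addrE.
  by have := phiL 1 (cls t) (cls u); rewrite !scale1r.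
- move=> a t ->; rewrite -fl_scalerE.
  by have := phiL a (cls t) 0; rewrite phi0 !addr0.
- by move=> t -> u ->; rewrite -fl_brE -[fl_br _ _]/(lieb _ _) phiB.
Qed.

End FreeLie.

(** * Linear bases of a possibly infinite-dimensional space.  The coordinates
    of a vector are a finitely supported function on the index type. *)

Section LinearSum.
Variables (k : fieldType) (K : choiceType) (V : lmodType k) (h : K -> V).

Definition lsum (c : {malg k[K]}) : V := \sum_(i <- msupp c) c@_i *: h i.

Lemma lsumEw (d : {fset K}) c : (msupp c `<=` d)%fset ->
  lsum c = \sum_(i <- d) c@_i *: h i.
Proof.
move=> sd; rewrite /lsum (big_fset_incl _ sd) // => i _ /mcoeff_outdom ->.
by rewrite scale0r.
Qed.

Lemma lsum_linear a c c' : lsum (a *: c + c') = a *: lsum c + lsum c'.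
Proof.
pose d := (msupp c `|` msupp c' `|` msupp (a *: c + c'))%fset.
rewrite !(@lsumEw d);
  try by apply/fsubsetP => i; rewrite !in_fsetU => ->; rewrite ?orbT.
rewrite scaler_sumr -big_split /=; apply: eq_bigr => i _.
by rewrite mcoeffD mcoeffZ scalerDl scalerA.
Qed.

Lemma lsumU i : lsum << i >> = h i.
Proof.
by rewrite /lsum msuppU oner_eq0 big_seq_fset1 mcoeffUU scale1r.
Qed.

End LinearSum.

Record linear_basis (k : fieldType) (V : lmodType k) := LinearBasis {
  basis_idx : choiceType;
  basis_vec :> basis_idx -> V;
  basisP : forall v : V, exists! c : {malg k[basis_idx]}, v = lsum basis_vec c
}.

Section Coordinates.
Variables (k : fieldType) (V : lmodType k) (e : linear_basis V).

Definition coords (v : V) : {malg k[basis_idx e]} := projT1 (cid (basisP e v)).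

Lemma coordsK v : lsum e (coords v) = v.
Proof. by rewrite /coords; case: cid => c [/= <- _]. Qed.

Lemma lsumK c : coords (lsum e c) = c.
Proof. by rewrite /coords; case: cid => c' [/= _ uniq]; exact: uniq. Qed.

Lemma coords_linear a u v : coords (a *: u + v) = a *: coords u + coords v.
Proof. by rewrite -{1}[u]coordsK -{1}[v]coordsK -lsum_linear lsumK. Qed.

Lemma coords_basis i : coords (e i) = << i >>.
Proof. by rewrite -[RHS]lsumK lsumU. Qed.

End Coordinates.

(** * Derivations of commutative algebras *)

Record is_derivation (k : fieldType) (A : comAlgType k) (D : A -> A) : Prop :=
  IsDerivation {
  der_linear : forall (a : k) x y, D (a *: x + y) = a *: D x + D y;
  der_mul : forall x y, D (x * y) = D x * y + x * D y
}.

(** [A] is generated by the family [X] as a unital algebra. *)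
Definition generates (k : fieldType) (A : comAlgType k) (I : Type)
    (X : I -> A) : Prop :=
  forall Q : A -> Prop, Q 1 -> (forall i, Q (X i)) ->
  (forall (a : k) x y, Q x -> Q y -> Q (a *: x + y)) ->
  (forall x y, Q x -> Q y -> Q (x * y)) -> forall f, Q f.

Section Derivations.
Variables (k : fieldType) (A : comAlgType k).
Implicit Types (D : A -> A).

Lemma der_1 D : is_derivation D -> D 1 = 0.
Proof.
move=> [_ DM]; have := DM 1 1; rewrite !mul1r mulr1 => /eqP.
by rewrite -subr_eq0 opprD addNKr oppr_eq0 => /eqP.
Qed.

Lemma der_uniq D D' (I : Type) (X : I -> A) :
  generates X -> is_derivation D -> is_derivation D' ->
  (forall i, D (X i) = D' (X i)) -> forall f, D f = D' f.
Proof.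
move=> gX HD HD' E; apply: (gX) => [|i|a x y Ex Ey|x y Ex Ey].
- by rewrite (der_1 HD) (der_1 HD').
- exact: E.
- by rewrite (der_linear HD) (der_linear HD') Ex Ey.
- by rewrite (der_mul HD) (der_mul HD') Ex Ey.
Qed.

Lemma der_lincomb D D' (a : k) : is_derivation D -> is_derivation D' ->
  is_derivation (fun f => a *: D f + D' f).
Proof.
move=> HD HD'; split=> [b x y|x y].
  rewrite (der_linear HD) (der_linear HD') !scalerDr !scalerA [b * a]mulrC.
  by rewrite addrACA.
rewrite (der_mul HD) (der_mul HD') mulrDl mulrDr scalerDr -!scalerAl -!scalerAr.
by rewrite addrACA.
Qed.

Lemma der_mulcomb D D' (g h : A) : is_derivation D -> is_derivation D' ->
  is_derivation (fun f => D f * h + g * D' f).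
Proof.
move=> HD HD'; split=> [b x y|x y].
  rewrite (der_linear HD) (der_linear HD') mulrDl mulrDr scalerDr.
  by rewrite -scalerAl -scalerAr addrACA.
by rewrite (der_mul HD) (der_mul HD'); ring.
Qed.

Lemma der_intro (T : Type) (mon : T -> A) D :
  (forall Q : A -> Prop, (forall u, Q (mon u)) ->
    (forall (a : k) x y, Q x -> Q y -> Q (a *: x + y)) -> forall f, Q f) ->
  (forall (a : k) x y, D (a *: x + y) = a *: D x + D y) ->
  (forall u v, D (mon u * mon v) = D (mon u) * mon v + mon u * D (mon v)) ->
  is_derivation D.
Proof.
move=> ind Dl DM; split=> //.
apply: (ind) => [u|a x y IHx IHy] g; last first.
  rewrite mulrDl -scalerAl !Dl IHx IHy.
  by rewrite !mulrDl -!scalerAl scalerDr addrACA.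
move: g; apply: (ind) => [v|a x y IHx IHy]; first exact: DM.
rewrite mulrDr -scalerAr !Dl IHx IHy.
by rewrite !mulrDr -!scalerAr scalerDr addrACA.
Qed.

End Derivations.

(** A bracket that is a derivation in each argument is a Lie bracket as soon
    as it satisfies the axioms of Lie algebras on a set of generators. *)

Section Biderivations.
Variables (k : fieldType) (A : comAlgType k) (I : Type) (X : I -> A).
Hypothesis gX : generates X.
Variable br : A -> A -> A.
Hypothesis br_derl : forall y, is_derivation (br^~ y).
Hypothesis br_derr : forall x, is_derivation (br x).

Let brl a x y z : br (a *: x + y) z = a *: br x z + br y z.
Proof. exact: (der_linear (br_derl z)). Qed.
Let brr a x y z : br z (a *: x + y) = a *: br z x + br z y.
Proof. exact: der_linear. Qed.
Let brMl x y z : br (x * y) z = br x z * y + x * br y z.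
Proof. exact: (der_mul (br_derl z)). Qed.
Let brMr x y z : br z (x * y) = br z x * y + x * br z y.
Proof. exact: der_mul. Qed.
Let br1l z : br 1 z = 0.
Proof. exact: (der_1 (br_derl z)). Qed.
Let br1r z : br z 1 = 0.
Proof. exact: der_1. Qed.
Let brDr x y z : br z (x + y) = br z x + br z y.
Proof. by have := brr 1 x y z; rewrite !scale1r. Qed.
Let brDl x y z : br (x + y) z = br x z + br y z.
Proof. by have := brl 1 x y z; rewrite !scale1r. Qed.
Let br0r z : br z 0 = 0.
Proof.
have /eqP := brDr 0 0 z.
by rewrite addr0 -subr_eq0 opprD addNKr oppr_eq0 => /eqP.
Qed.
Let brZr a x z : br z (a *: x) = a *: br z x.
Proof. by have := brr a x 0 z; rewrite br0r !addr0. Qed.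

Hypothesis brXX : forall i j, br (X i) (X j) + br (X j) (X i) = 0.
Hypothesis brX : forall i, br (X i) (X i) = 0.

Lemma bider_anti x y : br x y + br y x = 0.
Proof.
move: x y; apply: (gX) => [|i|a x y IHx IHy|x y IHx IHy] z.
- by rewrite br1l br1r addr0.
- move: z; apply: (gX) => [|j|a x y IHx IHy|x y IHx IHy].
  + by rewrite br1l br1r addr0.
  + exact: brXX.
  + by rewrite brl brr addrACA -scalerDr IHx IHy scaler0 addr0.
  + have -> : br (X i) (x * y) + br (x * y) (X i) =
      (br (X i) x + br x (X i)) * y + x * (br (X i) y + br y (X i)).
      by rewrite brMl brMr; ring.
    by rewrite IHx IHy mul0r mulr0 addr0.
- by rewrite brl brr addrACA -scalerDr IHx IHy scaler0 addr0.
- have -> : br (x * y) z + br z (x * y) =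
    (br x z + br z x) * y + x * (br y z + br z y).
    by rewrite brMl brMr; ring.
  by rewrite IHx IHy mul0r mulr0 addr0.
Qed.

Lemma bider_alt x : br x x = 0.
Proof.
move: x; apply: (gX) => [|i|a x y IHx IHy|x y IHx IHy].
- exact: br1l.
- exact: brX.
- rewrite brl !brr IHx IHy scaler0 add0r addr0 -scalerDr.
  by rewrite bider_anti scaler0.
- rewrite brMl !brMr IHx IHy.
  have -> : (0 * y + x * br x y) * y + x * (br y x * y + x * 0) =
    x * y * (br x y + br y x) by ring.
  by rewrite bider_anti mulr0.
Qed.

Let J x y z := br x (br y z) + br y (br z x) + br z (br x y).

Let J_rot x y z : J x y z = J y z x.
Proof. by rewrite /J -addrA addrC. Qed.

Let J_ind y z : (forall i, J (X i) y z = 0) -> forall x, J x y z = 0.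
Proof.
move=> JX; apply: (gX) => [|//|a p q IHp IHq|p q IHp IHq].
- by rewrite /J br1l br1r br1l !br0r !addr0.
- suff -> : J (a *: p + q) y z = a *: J p y z + J q y z.
    by rewrite IHp IHq scaler0 addr0.
  rewrite /J !brl !brr !scalerDr.
  by rewrite [X in X + _ = _]addrACA [LHS]addrACA.
- suff -> : J (p * q) y z = J p y z * q + p * J q y z +
      br z p * (br y q + br q y) + br z q * (br y p + br p y).
    by rewrite IHp IHq !bider_anti mul0r !mulr0 !addr0.
  by rewrite /J !brMl !brMr !brDr !brMr; ring.
Qed.

Hypothesis brJ : forall i j l, br (X i) (br (X j) (X l)) +
  br (X j) (br (X l) (X i)) + br (X l) (br (X i) (X j)) = 0.

Lemma bider_jacobi x y z : br x (br y z) + br y (br z x) + br z (br x y) = 0.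
Proof.
rewrite -[LHS]/(J x y z); move: x; apply: J_ind => i.
rewrite J_rot; move: y; apply: J_ind => j.
rewrite J_rot; move: z; apply: J_ind => l.
exact: brJ.
Qed.

End Biderivations.

(** * Polynomial algebras *)

Section Monomials.
Variables (k : fieldType) (I : choiceType) (A : comAlgType k).
Variable mon : {cmonom I} -> A.

(** The value \sum_i (du/dX_i) * d i, at the monomial [u], of the derivation
    sending the variable X_i to [d i]. *)
Definition deriv_mon (d : I -> A) (u : {cmonom I}) : A :=
  \sum_(i <- finsupp u) (u i)%:R *: (mon (divcm u (ucm i)) * d i).

Hypothesis monM : forall u v, mon u * mon v = mon (mmul u v).

Lemma deriv_monEw d (u : {cmonom I}) (D : {fset I}) : (finsupp u `<=` D)%fset ->
  deriv_mon d u = \sum_(i <- D) (u i)%:R *: (mon (divcm u (ucm i)) * d i).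
Proof.
move=> sD; rewrite /deriv_mon (big_fset_incl _ sD) // => i _.
by rewrite -cmE_eq0 => /eqP ->; rewrite scale0r.
Qed.

Lemma deriv_monM d (u v : {cmonom I}) :
  deriv_mon d (mmul u v) = deriv_mon d u * mon v + mon u * deriv_mon d v.
Proof.
pose D := (finsupp u `|` finsupp v)%fset.
rewrite !(@deriv_monEw d _ D) ?mdomD ?fsubsetUl ?fsubsetUr //.
rewrite mulr_suml mulr_sumr -big_split /=; apply: eq_bigr => i _.
rewrite cmM natrD scalerDl -scalerAl -scalerAr; congr (_ + _).
  case: (posnP (u i)) => [->|ui]; first by rewrite !scale0r.
  rewrite -mulrA [d i * _]mulrC mulrA monM; congr (_ *: _).
  congr (_ * _); congr (mon _); apply/eqP/cmP => j.
  rewrite cmM !divcmE cmM cmU; case: eqP => [<-|_]; last by rewrite !subn0.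
  by rewrite addnC -addnBA // addnC.
case: (posnP (v i)) => [->|vi]; first by rewrite !scale0r.
rewrite mulrA monM; congr (_ *: _); congr (_ * _); congr (mon _).
apply/eqP/cmP => j; rewrite cmM !divcmE cmM cmU.
by case: eqP => [<-|_]; rewrite ?subn0 // addnBA.
Qed.

Lemma deriv_monU d i : mon mone = 1 -> deriv_mon d (ucm i) = d i.
Proof.
move=> mon1; rewrite /deriv_mon mdomU big_seq_fset1 cmUU scale1r.
rewrite -[RHS]mul1r; congr (_ * _); rewrite -mon1; congr (mon _).
by apply/eqP/cmP => j; rewrite divcmE subnn cm1.
Qed.

End Monomials.

Definition polyalg (k : fieldType) (I : choiceType) : comAlgType k :=
  {malg k[{cmonom I}]}.

HB.lock Definition poly_mon (k : fieldType) (I : choiceType) (u : {cmonom I}) :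
  polyalg k I := (<< u >> : {malg k[{cmonom I}]}).

Definition poly_var (k : fieldType) (I : choiceType) (i : I) : polyalg k I :=
  poly_mon k (ucm i).

(** The linear map sending each monomial [u] to [h u]. *)
HB.lock Definition poly_lin (k : fieldType) (I : choiceType) (V : lmodType k)
    (h : {cmonom I} -> V) (f : polyalg k I) : V :=
  lsum h (f : {malg k[{cmonom I}]}).

Section PolynomialAlgebra.
Variables (k : fieldType) (I : choiceType).
Local Notation P := (polyalg k I).

Lemma cmonom_ind (Q : {cmonom I} -> Prop) :
  Q mone -> (forall i, Q (ucm i)) ->
  (forall u v, Q u -> Q v -> Q (mmul u v)) -> forall u, Q u.
Proof.
move=> Q1 QX QM u.
have [n] := ubnP (mdeg u); elim: n u => [u|n IH u]; first by rewrite ltn0.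
rewrite ltnS => le_un.
have [->|/eqP u1] := eqVneq u mone; first exact: Q1.
have [i iu] : exists i, u i != 0%N.
  apply: contrapT => /forallNP u0; apply: u1; apply/eqP/cmP => i.
  by rewrite cm1; apply/eqP; apply: contrapT => /negP; apply: u0.
have uE : u = mmul (ucm i) (divcm u (ucm i)).
  apply/eqP/cmP => j; rewrite cmM divcmE cmU.
  by case: eqP => [<-|_]; rewrite ?subn0 // subnKC // lt0n.
rewrite uE; apply: QM; first exact: QX.
apply: IH; apply: leq_trans le_un.
by rewrite [in X in (_ < X)%N]uE mdegM mdegU.
Qed.

Lemma poly_mon1 : poly_mon k mone = 1 :> P.
Proof. by rewrite poly_mon.unlock. Qed.

Lemma poly_monM (u v : {cmonom I}) :
  poly_mon k u * poly_mon k v = poly_mon k (mmul u v).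
Proof.
rewrite poly_mon.unlock.
suff E : << u >> * << v >> = << mmul u v >> :> {malg k[{cmonom I}]} by exact: E.
by rewrite malgM_def fgmulUU mulr1.
Qed.

Lemma poly_lin_mon (V : lmodType k) (h : {cmonom I} -> V) u :
  poly_lin h (poly_mon k u) = h u.
Proof. by rewrite poly_lin.unlock poly_mon.unlock; apply: lsumU. Qed.

Lemma poly_lin_linear (V : lmodType k) (h : {cmonom I} -> V) a f g :
  poly_lin h (a *: f + g) = a *: poly_lin h f + poly_lin h g.
Proof. by rewrite poly_lin.unlock; apply: lsum_linear. Qed.

Lemma malgUZ (c : k) (u : {cmonom I}) :
  << c *g u >> = c *: << u >> :> {malg k[{cmonom I}]}.
Proof.
apply: (proj1 (malgP _ _)) => v.
have E x : (<< x *g u >> : {malg k[{cmonom I}]})@_v = x *+ (u == v).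
  exact: mcoeffU.
rewrite mcoeffZ [LHS]E [X in _ * X]E.
by case: (u == v); rewrite /= ?mulr1 ?mulr0.
Qed.

Lemma poly_lin_ind (Q : P -> Prop) :
  (forall u, Q (poly_mon k u)) ->
  (forall a x y, Q x -> Q y -> Q (a *: x + y)) -> forall f, Q f.
Proof.
move=> QU Qlin f.
have Q0 : Q 0.
  by have := Qlin (-1) _ _ (QU mone) (QU mone); rewrite scaleN1r addNr.
have -> : f = \sum_(u <- msupp (f : {malg k[{cmonom I}]}))
  (f : {malg k[{cmonom I}]})@_u *: poly_mon k u.
  rewrite poly_mon.unlock {1}(monalgE f); apply: eq_bigr => u _.
  by rewrite malgUZ.
elim: (enum_fset _) => [|u s IH]; first by rewrite big_nil.
by rewrite big_cons; apply: Qlin.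
Qed.

Lemma poly_generates : generates (@poly_var k I).
Proof.
move=> Q Q1 QX Qlin Qmul; apply: poly_lin_ind; last exact: Qlin.
apply: cmonom_ind; [by rewrite poly_mon1 | exact: QX |].
by move=> u v Qu Qv; rewrite -poly_monM; apply: Qmul.
Qed.

Definition deriv_ext (d : I -> P) (f : P) : P :=
  poly_lin (deriv_mon (@poly_mon k I) d) f.

Lemma deriv_extP d : is_derivation (deriv_ext d).
Proof.
apply: (@der_intro k P _ (@poly_mon k I) (deriv_ext d)).
- exact: poly_lin_ind.
- exact: poly_lin_linear.
move=> u v; rewrite [X in deriv_ext d X]poly_monM.
have E w : deriv_ext d (poly_mon k w) = deriv_mon (@poly_mon k I) d w.
  exact: poly_lin_mon.
rewrite (E u) (E v) (E (mmul u v)); exact: (deriv_monM poly_monM).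
Qed.

Lemma deriv_extX d i : deriv_ext d (poly_var k i) = d i.
Proof.
rewrite /deriv_ext poly_lin_mon; apply: deriv_monU; exact: poly_mon1.
Qed.

Lemma deriv_ext_lin_d d d' (a : k) f :
  deriv_ext (fun i => a *: d i + d' i) f = a *: deriv_ext d f + deriv_ext d' f.
Proof.
move: f; apply: (der_uniq poly_generates (deriv_extP _)
  (der_lincomb a (deriv_extP d) (deriv_extP d'))).
by move=> i; rewrite !deriv_extX.
Qed.

Lemma deriv_ext_mul_d d d' g h f :
  deriv_ext (fun i => d i * h + g * d' i) f
    = deriv_ext d f * h + g * deriv_ext d' f.
Proof.
move: f; apply: (der_uniq poly_generates (deriv_extP _)
  (der_mulcomb g h (deriv_extP d) (deriv_extP d'))).
by move=> i; rewrite !deriv_extX.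
Qed.

End PolynomialAlgebra.

(** * Symmetric Poisson algebras *)

Section LieLemmas.
Variables (k : fieldType) (g : lieAlgType k).

Lemma lieb0r (x : g) : lieb x 0 = 0.
Proof.
by have := lieb_linearr (-1) 0 0 x; rewrite scaler0 addr0 scaleN1r addNr.
Qed.

Lemma lieb0l (x : g) : lieb 0 x = 0.
Proof.
by have := lieb_linearl (-1) 0 0 x; rewrite scaler0 addr0 scaleN1r addNr.
Qed.

Lemma liebC (x y : g) : lieb x y + lieb y x = 0.
Proof.
have lDl u v w : lieb (u + v) w = lieb u w + lieb v w :> g.
  by have := lieb_linearl 1 u v w; rewrite !scale1r.
have lDr u v w : lieb w (u + v) = lieb w u + lieb w v :> g.
  by have := lieb_linearr 1 u v w; rewrite !scale1r.
by have := liebxx (x + y); rewrite lDl !lDr !liebxx add0r addr0.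
Qed.

Lemma basis_ind (e : linear_basis g) (Q : g -> Prop) :
  Q 0 -> (forall i, Q (e i)) ->
  (forall (a : k) x y, Q x -> Q y -> Q (a *: x + y)) -> forall v, Q v.
Proof.
move=> Q0 Qe Ql v; rewrite -[v](coordsK e) /lsum.
elim: (enum_fset _) => [|i s IH]; first by rewrite big_nil.
by rewrite big_cons; apply: Ql.
Qed.

End LieLemmas.

(** The symmetric Poisson algebra of [g] is the polynomial algebra on a linear
    basis [e] of [g], with bracket
    {F, G} = \sum_(i, j) (dF/de_i) * (dG/de_j) * [e_i, e_j]. *)

Section SymmetricPoisson.
Variables (k : fieldType) (g : lieAlgType k) (e : linear_basis g).
Local Notation P := (polyalg k (basis_idx e)).

Definition sym_poisson : Type := P.
HB.instance Definition _ := GRing.ComAlgebra.copy sym_poisson P.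

(** The linear embedding of [g] as the span of the variables. *)
Definition sp_inj (v : g) : P := lsum (@poly_var k (basis_idx e)) (coords e v).

Definition sp_lieb (F G : P) : P :=
  deriv_ext (fun i => deriv_ext (fun j => sp_inj (lieb (e i) (e j))) G) F.

Lemma sp_inj_linear a u v : sp_inj (a *: u + v) = a *: sp_inj u + sp_inj v.
Proof. by rewrite /sp_inj coords_linear lsum_linear. Qed.

Lemma sp_inj_basis i : sp_inj (e i) = poly_var k i.
Proof. by rewrite /sp_inj coords_basis lsumU. Qed.

Lemma sp_inj0 : sp_inj 0 = 0.
Proof.
by have := sp_inj_linear (-1) 0 0; rewrite scaler0 addr0 scaleN1r addNr.
Qed.

Lemma sp_injD u v : sp_inj (u + v) = sp_inj u + sp_inj v.
Proof. by have := sp_inj_linear 1 u v; rewrite !scale1r. Qed.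

Lemma sp_derl G : is_derivation (sp_lieb^~ G).
Proof. exact: deriv_extP. Qed.

Lemma sp_derr F : is_derivation (sp_lieb F).
Proof.
split=> [a x y|x y]; rewrite /sp_lieb.
  apply: etrans (deriv_ext_lin_d _ _ a F); congr (deriv_ext _ F).
  by apply/funext => i; exact: (der_linear (deriv_extP _)).
apply: etrans (deriv_ext_mul_d _ _ x y F); congr (deriv_ext _ F).
by apply/funext => i; exact: (der_mul (deriv_extP _)).
Qed.

Lemma sp_lieb_var i j :
  sp_lieb (poly_var k i) (poly_var k j) = sp_inj (lieb (e i) (e j)).
Proof. by rewrite /sp_lieb !deriv_extX. Qed.

Let der0 (D : P -> P) : is_derivation D -> D 0 = 0.
Proof.
move=> H; have := der_linear H (-1) 0 0.
by rewrite scaler0 addr0 scaleN1r addNr.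
Qed.

Lemma sp_inj_lieb u v : sp_inj (lieb u v) = sp_lieb (sp_inj u) (sp_inj v).
Proof.
move: u v; apply: (basis_ind (e := e)) => [|i|a x y IHx IHy] v.
- by rewrite lieb0l sp_inj0 (der0 (sp_derl _)).
- move: v; apply: (basis_ind (e := e)) => [|j|a x y IHx IHy].
  + by rewrite lieb0r sp_inj0 (der0 (sp_derr _)).
  + by rewrite !sp_inj_basis sp_lieb_var.
  + by rewrite lieb_linearr !sp_inj_linear IHx IHy (der_linear (sp_derr _)).
- by rewrite lieb_linearl !sp_inj_linear IHx IHy (der_linear (sp_derl _)).
Qed.

Fact sp_liebXX i j :
  sp_lieb (poly_var k i) (poly_var k j) + sp_lieb (poly_var k j) (poly_var k i)
    = 0.
Proof. by rewrite !sp_lieb_var -sp_injD liebC sp_inj0. Qed.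

Fact sp_liebX i : sp_lieb (poly_var k i) (poly_var k i) = 0.
Proof. by rewrite sp_lieb_var liebxx sp_inj0. Qed.

Fact sp_liebxx F : sp_lieb F F = 0.
Proof.
exact: (bider_alt (@poly_generates _ _) sp_derl sp_derr sp_liebXX sp_liebX).
Qed.

Fact sp_jacobi F G H :
  sp_lieb F (sp_lieb G H) + sp_lieb G (sp_lieb H F) + sp_lieb H (sp_lieb F G)
    = 0.
Proof.
have E i j l :
    sp_lieb (poly_var k i) (sp_lieb (poly_var k j) (poly_var k l)) =
    sp_inj (lieb (e i) (lieb (e j) (e l))).
  by rewrite sp_inj_lieb (sp_lieb_var j l) sp_inj_basis.
apply: (bider_jacobi (@poly_generates _ _) sp_derl sp_derr sp_liebXX) => i j l.
rewrite (E i j l) (E j l i) (E l i j).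
rewrite -(sp_injD (lieb _ _) (lieb _ _)) -(sp_injD (_ + _) (lieb _ _)).
by rewrite lieb_jacobi sp_inj0.
Qed.

HB.instance Definition _ := Lmodule_isLie.Build k sym_poisson
  (fun a x y z => der_linear (sp_derl z) a x y)
  (fun a x y z => der_linear (sp_derr z) a x y)
  sp_liebxx sp_jacobi.
HB.instance Definition _ := LieComAlgebra_isPoisson.Build k sym_poisson
  (fun x => der_mul (sp_derr x)).

End SymmetricPoisson.

(** * The free Poisson algebra *)

Definition free_poisson (k : fieldType) (X : Type)
    (e : linear_basis (free_lie k X)) : poissonAlgType k := sym_poisson e.

Definition fp_gen (k : fieldType) (X : Type)
    (e : linear_basis (free_lie k X)) (x : X) : free_poisson e :=
  sp_inj e (fl_gen k x).
Arguments fp_gen {k X} e x.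

(** The Poisson subalgebra k{x : x in S} of k{X}. *)
Definition fp_subalgebra (k : fieldType) (X : Type)
    (e : linear_basis (free_lie k X)) (S : set X) : set (free_poisson e) :=
  subalgebra_gen [set fp_gen e x | x in S]%classic.
Arguments fp_subalgebra {k X} e S%_classical_set_scope.

(* Main.v *)
Require Import Defs.
From HB Require Import structures.
From mathcomp Require Import all_boot all_order all_algebra.
From mathcomp Require Import fieldext ring generic_quotient.
From mathcomp Require Import boolp classical_sets.
From mathcomp Require Import finmap monalg mpoly.
Set Implicit Arguments.
Unset Strict Implicit.
Unset Printing Implicit Defensive.
Import GRing.Theory.
Local Open Scope ring_scope.
Local Open Scope classical_set_scope.

(** Write [l] for the last variable.  The free Poisson algebra is mapped to a
    ring of differential polynomials J = k[q_w, T_al], where the coordinates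
    q_w are indexed by the words of length at most c and the T_al are the
    partial derivatives of one unknown function T of these coordinates.  The
    bracket of J is the Lie-Poisson bracket of the truncated free associative
    algebra, {q_u, q_v} = q_(uv) - q_(vu); a variable z_i other than [l] goes to
    q_i, and [l] goes to T.

    For c large this loses nothing: the Dynkin map q_w |-> w / |w|, with w read
    as a right-normed bracket, recovers an element from its image under
    z_i |-> q_i.  Hence f, which involves [l], becomes a differential polynomial
    that really involves T, and a nonzero h free of [l] becomes a nonzero
    polynomial in the q_w alone.

    A partial differential equation Y = 0 in one unknown T always has a formal
    solution at the generic point.  Pick the leading derivative of Y for a
    ranking, give it as value a root of an irreducible factor of Y over the
    field generated by the lower derivatives, and solve the derivatives of that
    factor, which are linear in their leading terms, for the remaining T_al.
    This is a homomorphism from J to a field which kills all derivatives of Y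
    but no nonzero polynomial in the q_w.  The elements of J all of whose
    derivatives are killed form a Poisson ideal, so h is not in (f). *)

(** * Evaluation and derivations of polynomial algebras *)

Section PolyalgEval.
Variables (k : fieldType) (I : choiceType).
Local Notation P := (polyalg k I).

Section MonomialEval.
Variables (S : comNzRingType) (v : I -> S).

Definition mon_ev (u : monalg.cmonom I) : S :=
  \prod_(i <- finsupp u) v i ^+ u i.

Fact mon_ev_mmorphism : monalg.mmorphism mon_ev.
Proof.
have E (u : monalg.cmonom I) (D : {fset I}) : (finsupp u `<=` D)%fset ->
    mon_ev u = \prod_(i <- D) v i ^+ u i.
  move=> sD; rewrite /mon_ev (big_fset_incl _ sD) // => i _.
  by rewrite -monalg.cmE_eq0 => /eqP ->; rewrite expr0.
split; last by rewrite /mon_ev monalg.mdom1 big_seq_fset0.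
move=> x y; pose D := (finsupp x `|` finsupp y)%fset.
rewrite !(@E _ D) ?monalg.mdomD ?fsubsetUl ?fsubsetUr //.
rewrite -big_split /=; apply: eq_bigr => i _.
by rewrite monalg.cmM exprD.
Qed.

HB.instance Definition _ :=
  monalg.isMultiplicative.Build _ _ mon_ev mon_ev_mmorphism.

End MonomialEval.

Lemma poly_ev_exists (S : comNzRingType) (sigma : {rmorphism k -> S})
    (v : I -> S) :
  exists phi : {rmorphism P -> S},
    (forall a, phi a%:A = sigma a) /\ (forall i, phi (poly_var k i) = v i).
Proof.
pose phi : {rmorphism P -> S} := monalg.mmap sigma (mon_ev v).
exists phi; split=> [a|i].
  rewrite -[a%:A]/(a *: (1 : monalg.malg _ k)).
  by rewrite /phi /= monalg.mmapZ monalg.mmap1 mulr1.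
rewrite /poly_var poly_mon.unlock /phi /=. rewrite monalg.mmapU.
transitivity (1 * mon_ev v (ucm i)); first by congr (_ * _); apply: rmorph1.
by rewrite mul1r /mon_ev monalg.mdomU big_seq_fset1 monalg.cmUU expr1.
Qed.

End PolyalgEval.

(** An interface to polynomial algebras that hides the monoid algebra behind them. Coefficients are
    mapped along an arbitrary [sigma], because later evaluations take values in a field [K] reached
    only through a ring morphism from [k]. *)
Record is_polyalg (k : fieldType) (I : Type) (A : comAlgType k) (X : I -> A) :
    Prop := IsPolyalg {
  polyalg_gen : generates X;
  polyalg_ev : forall (S : comNzRingType) (sigma : {rmorphism k -> S})
    (v : I -> S), exists phi : {rmorphism A -> S},
      (forall a, phi a%:A = sigma a) /\ (forall i, phi (X i) = v i);
  polyalg_der : forall d : I -> A, exists D : A -> A,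
      is_derivation D /\ (forall i, D (X i) = d i)
}.

Lemma polyalgP (k : fieldType) (I : choiceType) : is_polyalg (@poly_var k I).
Proof.
split=> [|S sigma v|d]; first exact: poly_generates.
  exact: poly_ev_exists.
by exists (deriv_ext d); split; [apply: deriv_extP | apply: deriv_extX].
Qed.

Section PolyEval.
Variables (k : fieldType) (I : Type) (A : comAlgType k) (X : I -> A).
Hypothesis HX : is_polyalg X.

Definition poly_ev (S : comNzRingType) (sigma : {rmorphism k -> S})
    (v : I -> S) : {rmorphism A -> S} :=
  projT1 (cid (polyalg_ev HX sigma v)).

Lemma poly_evC (S : comNzRingType) (sigma : {rmorphism k -> S}) v a :
  poly_ev sigma v a%:A = sigma a.
Proof. by rewrite /poly_ev; case: cid => phi [/= + _]; apply. Qed.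

Lemma poly_evX (S : comNzRingType) (sigma : {rmorphism k -> S}) v i :
  poly_ev sigma v (X i) = v i.
Proof. by rewrite /poly_ev; case: cid => phi [/= _]; apply. Qed.

Lemma poly_evZ (S : comNzRingType) (sigma : {rmorphism k -> S}) v a f :
  poly_ev sigma v (a *: f) = sigma a * poly_ev sigma v f.
Proof. by rewrite -[f in LHS]mul1r scalerAl rmorphM poly_evC. Qed.

Definition poly_der (d : I -> A) : A -> A :=
  projT1 (cid (polyalg_der HX d)).

Lemma poly_derP d : is_derivation (poly_der d).
Proof. by rewrite /poly_der; case: cid => D []. Qed.

Lemma poly_derX d i : poly_der d (X i) = d i.
Proof. by rewrite /poly_der; case: cid => D []. Qed.

End PolyEval.

(** * Subalgebras generated by sets of variables *)

Section SubAlgebras.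
Variables (k : fieldType) (A : comAlgType k).

Inductive subalg (S : A -> Prop) : A -> Prop :=
  | subalg_1 : subalg S 1
  | subalg_in x : S x -> subalg S x
  | subalg_lin (a : k) x y :
      subalg S x -> subalg S y -> subalg S (a *: x + y)
  | subalg_mul x y : subalg S x -> subalg S y -> subalg S (x * y).

Variable S : A -> Prop.

Lemma subalg_0 : subalg S 0.
Proof.
rewrite -(addNr 1) -scaleN1r; apply: subalg_lin; exact: subalg_1.
Qed.

Lemma subalg_add x y : subalg S x -> subalg S y -> subalg S (x + y).
Proof. by move=> Sx Sy; rewrite -[x]scale1r; apply: subalg_lin. Qed.

Lemma subalg_scale (a : k) x : subalg S x -> subalg S (a *: x).
Proof. by move=> Sx; rewrite -[_ *: _]addr0; apply: subalg_lin subalg_0. Qed.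

Lemma subalg_sum (T : Type) (r : seq T) (F : T -> A) :
  (forall i, subalg S (F i)) -> subalg S (\sum_(i <- r) F i).
Proof.
move=> SF; elim: r => [|i r IH]; first by rewrite big_nil; apply: subalg_0.
by rewrite big_cons; apply: subalg_add.
Qed.

Lemma subalg_exp x n : subalg S x -> subalg S (x ^+ n).
Proof.
move=> Sx; elim: n => [|n IH]; first exact: subalg_1.
by rewrite exprS; apply: subalg_mul.
Qed.

Lemma subalg_trans (S' : A -> Prop) x :
  (forall y, S y -> subalg S' y) -> subalg S x -> subalg S' x.
Proof.
move=> SS'; elim=> [|y /SS' //|a y z _ IHy _ IHz|y z _ IHy _ IHz].
- exact: subalg_1.
- exact: subalg_lin.
- exact: subalg_mul.
Qed.

Lemma subalg_ev (B : comNzRingType) (phi psi : {rmorphism A -> B}) x :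
  (forall a, phi a%:A = psi a%:A) -> (forall y, S y -> phi y = psi y) ->
  subalg S x -> phi x = psi x.
Proof.
move=> E ES; elim=> [|y /ES //|a y z _ IHy _ IHz|y z _ IHy _ IHz].
- by rewrite !rmorph1.
- by rewrite -[y]mul1r scalerAl !rmorphD !rmorphM IHy IHz E.
- by rewrite !rmorphM IHy IHz.
Qed.

End SubAlgebras.

Lemma subalg_mono (k : fieldType) (A : comAlgType k) (S S' : A -> Prop) x :
  (forall y, S y -> S' y) -> subalg S x -> subalg S' x.
Proof. by move=> SS'; apply: subalg_trans => y /SS'; apply: subalg_in. Qed.

Section VariableSubAlgebras.
Variables (k : fieldType) (I : choiceType) (A : comAlgType k) (X : I -> A).

Definition polyvars (V : I -> Prop) : A -> Prop :=
  subalg (fun y => exists2 i, V i & y = X i).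

Lemma polyvarsX (V : I -> Prop) i : V i -> polyvars V (X i).
Proof. by move=> Vi; apply: subalg_in; exists i. Qed.

Lemma polyvars_mono (V V' : I -> Prop) f :
  (forall i, V i -> V' i) -> polyvars V f -> polyvars V' f.
Proof.
by move=> VV'; apply: subalg_mono => y [i /VV' Vi ->]; exists i.
Qed.

Lemma polyvars_finite f (V : I -> Prop) : polyvars V f ->
  exists2 s : seq I, (forall i, i \in s -> V i) & polyvars (fun i => i \in s) f.
Proof.
elim=> {f} [|f [i Vi ->]|a f g _ [s sV Sf] _ [t tV Tg]|
    f g _ [s sV Sf] _ [t tV Tg]].
- by exists [::] => //; apply: subalg_1.
- exists [:: i] => [j|]; first by rewrite inE => /eqP ->.
  by apply: polyvarsX; rewrite inE.
- exists (s ++ t) => [i|]; first by rewrite mem_cat => /orP [/sV|/tV].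
  apply: subalg_lin; [move: Sf|move: Tg]; apply: polyvars_mono => i ii;
    by rewrite mem_cat ii ?orbT.
- exists (s ++ t) => [i|]; first by rewrite mem_cat => /orP [/sV|/tV].
  apply: subalg_mul; [move: Sf|move: Tg]; apply: polyvars_mono => i ii;
    by rewrite mem_cat ii ?orbT.
Qed.

Hypothesis HX : is_polyalg X.

Lemma polyvars_all f : polyvars (fun=> True) f.
Proof.
move: f; apply: (polyalg_gen HX) => [|i|a x y|x y].
- exact: subalg_1.
- exact: polyvarsX.
- exact: subalg_lin.
- exact: subalg_mul.
Qed.

Lemma polyvars_ev (S : comNzRingType) (sigma : {rmorphism k -> S}) v v'
    (V : I -> Prop) f :
  (forall i, V i -> v i = v' i) -> polyvars V f ->
  poly_ev HX sigma v f = poly_ev HX sigma v' f.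
Proof.
move=> E; apply: subalg_ev => [a|y [i Vi ->]]; first by rewrite !poly_evC.
by rewrite !poly_evX E.
Qed.

(** Two sets of variables occur because a derivation may raise the order of a jet. The inclusion of
    [V] in [V'] accounts for the undifferentiated factors in the Leibniz rule. *)
Lemma polyvars_der (D : A -> A) (V V' : I -> Prop) f :
  is_derivation D -> (forall i, V i -> V' i) ->
  (forall i, V i -> polyvars V' (D (X i))) ->
  polyvars V f -> polyvars V' (D f).
Proof.
move=> HD VV' DV; elim=> {f} [|f [i Vi ->]|a f g _ IHf _ IHg|f g Vf IHf Vg IHg].
- rewrite (der_1 HD); exact: subalg_0.
- exact: DV.
- by rewrite (der_linear HD); apply: subalg_lin.
- rewrite (der_mul HD); apply: subalg_add; apply: subalg_mul => //;
    exact: polyvars_mono VV' _.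
Qed.

End VariableSubAlgebras.

(** * Morphisms of Poisson algebras *)

Section LieIdentities.
Variables (k : fieldType) (g : lieAlgType k).

Lemma lieb_opp (x y : g) : lieb x y = - lieb y x.
Proof. by apply/eqP; rewrite -subr_eq0 opprK liebC. Qed.

Lemma lieb_oppr (x y : g) : lieb x (- y) = - lieb x y.
Proof.
have := lieb_linearr (-1) y 0 x; rewrite addr0 !scaleN1r => ->.
by rewrite lieb0r addr0.
Qed.

Lemma lieb_ad (x y w : g) :
  lieb (lieb x y) w = lieb x (lieb y w) - lieb y (lieb x w).
Proof.
have := lieb_jacobi x y w; rewrite (lieb_opp w x) lieb_oppr.
rewrite (lieb_opp w (lieb x y)) => /eqP; rewrite subr_eq0 => /eqP ->.
by [].
Qed.

End LieIdentities.

Section PoissonMorphisms.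
Variable k : fieldType.

Record poisson_hom (B C : poissonAlgType k) (phi : {rmorphism B -> C}) :
    Prop := PoissonHom {
  phom_scale : forall (a : k) x, phi (a *: x) = a *: phi x;
  phom_lieb : forall x y, phi (lieb x y) = lieb (phi x) (phi y)
}.

Lemma phom_comp (B C D : poissonAlgType k) (phi : {rmorphism C -> D})
    (psi : {rmorphism B -> C}) :
  poisson_hom phi -> poisson_hom psi -> poisson_hom (phi \o psi).
Proof.
move=> [phiZ phiL] [psiZ psiL]; split=> [a x|x y] /=.
  by rewrite psiZ phiZ.
by rewrite psiL phiL.
Qed.

Lemma phom_subalgebra (B C : poissonAlgType k) (phi : {rmorphism B -> C}) S :
  poisson_hom phi -> poisson_subalgebra S ->
  poisson_subalgebra [set x | S (phi x)].
Proof.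
move=> [phiZ phiL] [S1 Sl SM SL]; split=> /= [|a x y Sx Sy|x y Sx Sy|x y Sx Sy].
- by rewrite rmorph1.
- by rewrite rmorphD phiZ; apply: Sl.
- by rewrite rmorphM; apply: SM.
- by rewrite phiL; apply: SL.
Qed.

Lemma phom_eq_subalgebra (B C : poissonAlgType k)
    (phi psi : {rmorphism B -> C}) :
  poisson_hom phi -> poisson_hom psi ->
  poisson_subalgebra [set x | phi x = psi x].
Proof.
move=> [phiZ phiL] [psiZ psiL]; split=> /= [|a x y Ex Ey|x y Ex Ey|x y Ex Ey].
- by rewrite !rmorph1.
- by rewrite !rmorphD phiZ psiZ Ex Ey.
- by rewrite !rmorphM Ex Ey.
- by rewrite phiL psiL Ex Ey.
Qed.

Lemma psub_0 (B : poissonAlgType k) (S : set B) : poisson_subalgebra S -> S 0.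
Proof.
move=> [S1 Sl _ _]; rewrite -(addNr 1) -scaleN1r; exact: Sl.
Qed.

Lemma subalgebra_gen_poisson (B : poissonAlgType k) (S : set B) :
  poisson_subalgebra (subalgebra_gen S).
Proof.
split=> [T [[]]|a x y Sx Sy T HT|x y Sx Sy T HT|x y Sx Sy T HT] //;
  case: (HT) => -[T1 Tl TM TL] ST.
- by apply: Tl; [apply: Sx|apply: Sy].
- by apply: TM; [apply: Sx|apply: Sy].
- by apply: TL; [apply: Sx|apply: Sy].
Qed.

Lemma subalgebra_gen_in (B : poissonAlgType k) (S : set B) x :
  S x -> subalgebra_gen S x.
Proof. by move=> Sx T [_]; apply. Qed.

Lemma subalgebra_gen_ind (B : poissonAlgType k) (S T : set B) x :
  poisson_subalgebra T -> S `<=` T -> subalgebra_gen S x -> T x.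
Proof. by move=> HT ST; apply. Qed.

Lemma ideal_gen_ind (B : poissonAlgType k) (f : B) (J : set B) x :
  poisson_ideal J -> J f -> ideal_gen f x -> J x.
Proof. by move=> HJ Jf; apply; split=> // y ->. Qed.

End PoissonMorphisms.

Section BiderivationMorphisms.
Variables (k : fieldType) (A : comAlgType k) (B : poissonAlgType k).
Variables (br : A -> A -> A) (phi : {rmorphism A -> B}).
Hypothesis br_derl : forall y, is_derivation (br^~ y).
Hypothesis br_derr : forall x, is_derivation (br x).
Hypothesis phiL : forall (a : k) x y, phi (a *: x + y) = a *: phi x + phi y.

Lemma lieb_derr (x : B) : is_derivation (lieb x).
Proof. by split=> [a z w|z w]; [apply: lieb_linearr | apply: lieb_leibniz]. Qed.

Lemma lieb_derl (x : B) : is_derivation (fun z : B => lieb z x).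
Proof.
split=> [a z w|z w]; first exact: lieb_linearl.
by rewrite lieb_opp lieb_leibniz (lieb_opp z) (lieb_opp w); ring.
Qed.

(** Both sides are derivations along [phi] in each argument, so agreement on generators propagates,
    first in [x] and then, for [x] a generator, in [y]. *)
Lemma bider_morph (I : Type) (X : I -> A) : generates X ->
  (forall i j, phi (br (X i) (X j)) = lieb (phi (X i)) (phi (X j))) ->
  forall x y, phi (br x y) = lieb (phi x) (phi y).
Proof.
move=> gX E x y.
move: x; apply: (gX) => [|i|a x z IHx IHz|x z IHx IHz].
- by rewrite (der_1 (br_derl y)) rmorph1 rmorph0 (der_1 (lieb_derl _)).
- move: y; apply: (gX) => [|j|a x z IHx IHz|x z IHx IHz].
  + by rewrite (der_1 (br_derr _)) rmorph1 rmorph0 (der_1 (lieb_derr _)).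
  + exact: E.
  + rewrite (der_linear (br_derr _)) !phiL IHx IHz.
    by rewrite (der_linear (lieb_derr _)).
  + rewrite (der_mul (br_derr _)) rmorphD !rmorphM IHx IHz.
    by rewrite (der_mul (lieb_derr _)).
- rewrite (der_linear (br_derl _)) !phiL IHx IHz.
  by rewrite (der_linear (lieb_derl _)).
- rewrite (der_mul (br_derl _)) rmorphD !rmorphM IHx IHz.
  by rewrite (der_mul (lieb_derl _)).
Qed.

End BiderivationMorphisms.

Section SymmetricPoissonMorphisms.
Variables (k : fieldType) (g : lieAlgType k) (e : linear_basis g).
Local Notation P := (polyalg k (basis_idx e)).

(** Universal property of the symmetric Poisson algebra: the values of [h] on the basis define an
    algebra morphism, and compatibility with brackets need only be checked on variables. *)
Lemma sp_ev_exists (B : poissonAlgType k) (h : g -> B) :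
  (forall (a : k) u v, h (a *: u + v) = a *: h u + h v) ->
  (forall u v, h (lieb u v) = lieb (h u) (h v)) ->
  exists2 phi : {rmorphism sym_poisson e -> B}, poisson_hom phi &
    forall v, phi (sp_inj e v) = h v.
Proof.
move=> hl hL.
have h0 : h 0 = 0.
  by have := hl (-1) 0 0; rewrite scaler0 addr0 scaleN1r addNr.
have [phi phiL phiX] : exists2 phi : {rmorphism P -> B},
    forall (a : k) x z, phi (a *: x + z) = a *: phi x + phi z &
    forall i, phi (poly_var k i) = h (e i).
  exists (poly_ev (polyalgP k _) (in_alg B) (fun i => h (e i))) => [a x z|i];
    last first.
    exact: poly_evX.
  by rewrite rmorphD poly_evZ /= mulr_algl.
have phiI v : phi (sp_inj e v) = h v.
  move: v; apply: (basis_ind (e := e)) => [|i|a x z IHx IHz].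
  - by rewrite sp_inj0 rmorph0.
  - by rewrite sp_inj_basis phiX.
  - by rewrite sp_inj_linear hl -IHx -IHz; exact: phiL.
exists (phi : {rmorphism sym_poisson e -> B}); last exact: phiI.
split=> [a x|].
  by have := phiL a x 0; rewrite rmorph0 !addr0; exact.
apply: (bider_morph (@sp_derl k g e) (@sp_derr k g e) phiL
  (@poly_generates k _)) => i j.
by rewrite sp_lieb_var phiI hL !phiX.
Qed.

End SymmetricPoissonMorphisms.

(** * The universal property of the free Poisson algebra *)

Section FreePoisson.
Variables (k : fieldType) (X : Type) (e : linear_basis (free_lie k X)).
Local Notation F := (free_poisson e).

Lemma fp_var (i : basis_idx e) : poly_var k i = sp_inj e (e i).
Proof. by rewrite sp_inj_basis. Qed.

Lemma free_lie_ind (Q : free_lie k X -> Prop) :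
  (forall x, Q (fl_gen k x)) ->
  (forall (a : k) u v, Q u -> Q v -> Q (a *: u + v)) ->
  (forall u v, Q u -> Q v -> Q (lieb u v)) -> Q 0 -> forall v, Q v.
Proof.
move=> QX Ql QL Q0 v; have [t ->] := fl_clsP v; elim: t => {v}.
- exact: QX.
- exact: Q0.
- move=> t Qt u Qu; by have := Ql 1 _ _ Qt Qu; rewrite scale1r fl_addrE.
- move=> a t Qt; by have := Ql a _ _ Qt Q0; rewrite addr0 fl_scalerE.
- move=> t Qt u Qu; rewrite -fl_brE; exact: QL.
Qed.

(** The polynomial variables are basis vectors of the free Lie algebra, and these are Lie
    polynomials in the free generators. *)
Lemma fp_generated (f : F) :
  subalgebra_gen [set fp_gen e x | x in setT] f.
Proof.
have HS := subalgebra_gen_poisson [set fp_gen e x | x in setT].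
have [S1 Sl SM SL] := HS.
apply: (@poly_generates k (basis_idx e)) => // i.
rewrite fp_var; move: (e i); apply: free_lie_ind => [x|a u v Su Sv|u v Su Sv|].
- by apply: subalgebra_gen_in; exists x.
- by rewrite sp_inj_linear; apply: (Sl a (sp_inj e u) (sp_inj e v)).
- rewrite sp_inj_lieb; exact: (SL (sp_inj e u) (sp_inj e v)).
- by rewrite sp_inj0; apply: (psub_0 HS).
Qed.

Lemma fp_hom_eq (B : poissonAlgType k) (phi psi : {rmorphism F -> B}) :
  poisson_hom phi -> poisson_hom psi ->
  (forall x, phi (fp_gen e x) = psi (fp_gen e x)) -> phi =1 psi.
Proof.
move=> Hphi Hpsi E f.
apply: (subalgebra_gen_ind (phom_eq_subalgebra Hphi Hpsi) _ (fp_generated f)).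
by move=> _ [x _ <-]; apply: E.
Qed.

Lemma fp_ev_exists (B : poissonAlgType k) (y : X -> B) :
  exists2 phi : {rmorphism F -> B}, poisson_hom phi &
    forall x, phi (fp_gen e x) = y x.
Proof.
have [h [[hl hL hX] _]] := free_lie_universal y.
have [phi Hphi phiI] := sp_ev_exists e hl hL.
by exists phi => // x; rewrite -hX -phiI.
Qed.

End FreePoisson.

(** * Poisson brackets given by commuting derivations *)

Lemma der_0 (k : fieldType) (A : comAlgType k) (D : A -> A) :
  is_derivation D -> D 0 = 0.
Proof.
move=> HD; have := der_linear HD (-1) 0 0.
by rewrite scaler0 addr0 scaleN1r addNr.
Qed.

Lemma der_add (k : fieldType) (A : comAlgType k) (D : A -> A) x y :
  is_derivation D -> D (x + y) = D x + D y.
Proof. by move=> HD; have := der_linear HD 1 x y; rewrite !scale1r. Qed.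

Lemma der_scale (k : fieldType) (A : comAlgType k) (D : A -> A) (a : k) x :
  is_derivation D -> D (a *: x) = a *: D x.
Proof.
by move=> HD; have := der_linear HD a x 0; rewrite (der_0 HD) !addr0.
Qed.

Lemma der_opp (k : fieldType) (A : comAlgType k) (D : A -> A) x :
  is_derivation D -> D (- x) = - D x.
Proof. by move=> HD; rewrite -!scaleN1r der_scale. Qed.

Lemma der_sum (k : fieldType) (A : comAlgType k) (D : A -> A) (I : Type)
    (r : seq I) (F : I -> A) :
  is_derivation D -> D (\sum_(i <- r) F i) = \sum_(i <- r) D (F i).
Proof.
move=> HD; elim: r => [|i r IH]; first by rewrite !big_nil der_0.
by rewrite !big_cons der_add // IH.
Qed.

(** The commutator of two derivations is a derivation, hence vanishes once it vanishes on
    generators. *)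
Lemma der_commute (k : fieldType) (A : comAlgType k) (I : Type) (X : I -> A)
    (D E : A -> A) :
  generates X -> is_derivation D -> is_derivation E ->
  (forall i, D (E (X i)) = E (D (X i))) -> forall x, D (E x) = E (D x).
Proof.
move=> gX HD HE DE; apply: gX => [|//|a x y IHx IHy|x y IHx IHy].
- by rewrite (der_1 HD) (der_1 HE) (der_0 HD) (der_0 HE).
- by rewrite !(der_linear HD, der_linear HE) IHx IHy.
- rewrite !(der_mul HD, der_mul HE) (der_add _ _ HD) (der_add _ _ HE).
  by rewrite !(der_mul HD, der_mul HE) IHx IHy; ring.
Qed.

Lemma sum_alternating (V : zmodType) n (F : 'I_n -> 'I_n -> V) :
  (forall i, F i i = 0) -> (forall i j, F i j + F j i = 0) ->
  \sum_i \sum_j F i j = 0.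
Proof.
move=> F0 FC.
have E i : \sum_j F i j =
    \sum_(j < n | (j < i)%N) F i j + \sum_(j < n | (i < j)%N) F i j.
  rewrite (bigID (fun j : 'I_n => (j < i)%N)) /=; congr (_ + _).
  rewrite (bigD1 i) ?ltnn //= F0 add0r; apply: eq_bigl => j.
  by rewrite -leqNgt ltn_neqAle andbC eq_sym.
under eq_bigr do rewrite E.
rewrite big_split /= [X in _ + X](exchange_big_dep xpredT) //= -big_split /=.
apply: big1 => i _; rewrite -big_split /=.
by apply: big1 => j _; rewrite FC.
Qed.

Section Bivectors.
Variables (k : fieldType) (A : comAlgType k) (n : nat).
Variables (d : 'I_n -> A -> A) (q : 'I_n -> A) (pi : 'I_n -> 'I_n -> A).
Hypothesis dP : forall i, is_derivation (d i).
Hypothesis dC : forall i j x, d i (d j x) = d j (d i x).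
Hypothesis dq : forall i j, d i (q j) = (i == j)%:R.
Hypothesis pi_alt : forall i, pi i i = 0.
Hypothesis pi_anti : forall i j, pi i j + pi j i = 0.
Hypothesis pi_jacobi : forall i j l,
  \sum_s d s (pi j l) * pi i s + \sum_s d s (pi l i) * pi j s
    + \sum_s d s (pi i j) * pi l s = 0.

Definition bv_br (x y : A) : A := \sum_i \sum_j d i x * d j y * pi i j.

Lemma bv_brC x y : bv_br x y = - bv_br y x.
Proof.
rewrite /bv_br [X in - X]exchange_big /= -sumrN; apply: eq_bigr => i _.
rewrite -sumrN; apply: eq_bigr => j _.
have /eqP := pi_anti i j; rewrite addr_eq0 => /eqP ->; ring.
Qed.

Lemma bv_brxx x : bv_br x x = 0.
Proof.
apply: sum_alternating => [i|i j]; first by rewrite pi_alt mulr0.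
by rewrite [d j x * _]mulrC -mulrDr pi_anti mulr0.
Qed.

Lemma bv_derl y : is_derivation (bv_br^~ y).
Proof.
split=> [a x z|x z]; rewrite /bv_br.
  rewrite scaler_sumr -big_split /=; apply: eq_bigr => i _.
  rewrite scaler_sumr -big_split /=; apply: eq_bigr => j _.
  by rewrite (der_linear (dP i)) !mulrDl -!scalerAl.
rewrite mulr_suml mulr_sumr -big_split /=; apply: eq_bigr => i _.
rewrite mulr_suml mulr_sumr -big_split /=; apply: eq_bigr => j _.
by rewrite (der_mul (dP i)); ring.
Qed.

Lemma bv_derr x : is_derivation (bv_br x).
Proof.
split=> [a y z|y z]; rewrite ![bv_br x _]bv_brC.
  by rewrite (der_linear (bv_derl x)) opprD scalerN.
by rewrite (der_mul (bv_derl x)); ring.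
Qed.

Lemma bv_brqE i y : bv_br (q i) y = \sum_j d j y * pi i j.
Proof.
rewrite /bv_br (bigD1 i) //= [X in _ + X]big1 => [|l /negPf li].
  by rewrite addr0; apply: eq_bigr => j _; rewrite dq eqxx mul1r.
by apply: big1 => j _; rewrite dq li !mul0r.
Qed.

Lemma bv_brqq i j : bv_br (q i) (q j) = pi i j.
Proof.
rewrite bv_brqE (bigD1 j) //= dq eqxx mul1r big1 ?addr0 // => l /negPf lj.
by rewrite dq lj mul0r.
Qed.

Lemma bv_brEl x y : bv_br x y = \sum_l d l x * bv_br (q l) y.
Proof.
rewrite {1}/bv_br; apply: eq_bigr => i _; rewrite bv_brqE mulr_sumr.
by apply: eq_bigr => j _; rewrite mulrA.
Qed.

Lemma bv_brEr x y : bv_br x y = \sum_l d l y * bv_br x (q l).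
Proof.
rewrite bv_brC bv_brEl -sumrN; apply: eq_bigr => l _.
by rewrite [bv_br x _]bv_brC mulrN.
Qed.

Let Jac x y z :=
  bv_br x (bv_br y z) + bv_br y (bv_br z x) + bv_br z (bv_br x y).

Let Jac_rot x y z : Jac x y z = Jac y z x.
Proof. by rewrite /Jac -addrA addrC. Qed.

(* The terms with second derivatives of x cancel because the d commute. *)
Let JacE x y z : Jac x y z = \sum_l d l x * Jac (q l) y z.
Proof.
pose C1 := \sum_l bv_br y (d l x) * bv_br z (q l).
pose C2 := \sum_l bv_br z (d l x) * bv_br (q l) y.
have C0 : C1 + C2 = 0.
  rewrite /C1 /C2.
  under eq_bigr do rewrite bv_brEr mulr_suml.
  under [X in _ + X]eq_bigr do rewrite bv_brEr mulr_suml.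
  rewrite [X in _ + X]exchange_big /= -big_split /=; apply: big1 => l _.
  rewrite -big_split /=; apply: big1 => p _.
  by rewrite (dC p l) [bv_br (q p) y]bv_brC; ring.
have E2 : bv_br y (bv_br z x) = C1 + \sum_l d l x * bv_br y (bv_br z (q l)).
  rewrite [bv_br z x]bv_brEr (der_sum _ _ (bv_derr y)) -big_split /=.
  by apply: eq_bigr => l _; rewrite (der_mul (bv_derr y)).
have E3 : bv_br z (bv_br x y) = C2 + \sum_l d l x * bv_br z (bv_br (q l) y).
  rewrite [bv_br x y]bv_brEl (der_sum _ _ (bv_derr z)) -big_split /=.
  by apply: eq_bigr => l _; rewrite (der_mul (bv_derr z)).
rewrite /Jac E2 E3 [bv_br x (bv_br y z)]bv_brEl.
under [RHS]eq_bigr do rewrite !mulrDr.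
rewrite !big_split /=.
set a := \sum_(i < n) _; set b := \sum_(i < n) _; set c := \sum_(i < n) _.
have -> : a + (C1 + b) + (C2 + c) = (C1 + C2) + (a + b + c) by ring.
by rewrite C0 add0r.
Qed.

(** The [q i] need not generate [A], so this is not a reduction to generators. Instead [JacE] shows
    that the Jacobiator is a first-order operator in one argument; rotating and applying it three
    times leaves only coordinates, where [pi_jacobi] is the required identity. *)
Lemma bv_jacobi x y z :
  bv_br x (bv_br y z) + bv_br y (bv_br z x) + bv_br z (bv_br x y) = 0.
Proof.
rewrite -[LHS]/(Jac x y z) JacE; apply: big1 => i _.
rewrite Jac_rot JacE big1 ?mulr0 // => j _.
rewrite Jac_rot JacE big1 ?mulr0 // => l _.
by rewrite /Jac !bv_brqq !bv_brqE pi_jacobi mulr0.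
Qed.

End Bivectors.

(** * Adjoining a simple root *)

Lemma frac_denom (R : idomainType) (x : {fraction R}) :
  exists2 b : R, b != 0 & exists a, tofrac b * x = tofrac a.
Proof.
elim/quotW: x => r; exists \d_r; first exact: denom_ratioP.
exists \n_r; unlock tofrac; rewrite -[LHS]FracField.pi_mul.
apply/eqmodP; rewrite /= FracField.equivfE /FracField.mulf.
by rewrite !numden_Ratio ?(oner_neq0, mulf_neq0, denom_ratioP) //= ?mulr1
  ?mul1r mulrC.
Qed.

Lemma poly_denom (R : idomainType) (p : {poly {fraction R}}) :
  exists2 b : R, b != 0 &
    exists q : {poly R}, tofrac b *: p = map_poly (@tofrac R) q.
Proof.
elim/poly_ind: p => [|p x [b b0 [q Eq]]].
  by exists 1; [exact: oner_neq0 | exists 0; rewrite scaler0 rmorph0].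
have [c c0 [a Ea]] := frac_denom x.
exists (b * c); first exact: mulf_neq0.
exists (c *: q * 'X + (b * a)%:P).
have Eq' i : tofrac b * p`_i = tofrac q`_i.
  by rewrite -coefZ Eq coef_map.
apply/polyP => i; rewrite coefZ coef_map /= !coefD !coefMX !coefC coefZ.
rewrite rmorphD mulrDr; case: i => [|i] /=; rewrite !rmorphM /=.
  by rewrite rmorph0 mulr0 !add0r -Ea mulrA.
by rewrite -Eq' rmorph0 mulr0 !addr0 mulrCA mulrA.
Qed.

Lemma irreducible_factor (F : fieldType) (p : {poly F}) : (1 < size p)%N ->
  exists2 q, irreducible_poly q & q %| p.
Proof.
have [n] := ubnP (size p); elim: n p => // n IH p; rewrite ltnS => sp p1.
case: (pselect (irreducible_poly p)) => [irr|nirr]; first by exists p.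
have [q [q1 qp nqp]] : exists q : {poly F}, [/\ size q != 1, q %| p & ~~ (q %=
  p)].
  apply: contrapT => H; apply: nirr; split=> // q q1 qp.
  by apply: contrapT => /negP nqp; apply: H; exists q.
have p0 : p != 0 by rewrite -size_poly_gt0 ltnW.
have q0 : q != 0 by apply: contraNneq p0 => q0; rewrite -dvd0p -q0.
have [||r irr rq] := IH q.
- apply: leq_trans sp; rewrite ltn_neqAle dvdp_leq // andbT.
  by apply: contra nqp; rewrite dvdp_size_eqp.
- by rewrite ltn_neqAle eq_sym q1 size_poly_gt0.
by exists r => //; apply: dvdp_trans rq qp.
Qed.

(** Otherwise the gcd of [q] and its derivative is associate to [q], so [q] divides a nonzero
    polynomial of smaller degree. *)
Lemma irreducible_separable (F : fieldType) (q : {poly F}) :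
  (forall n, n.+1%:R != 0 :> F) -> irreducible_poly q -> coprimep q q^`().
Proof.
move=> char0 [q1 irr].
have q0 : q != 0 by rewrite -size_poly_gt0 ltnW.
have dq0 : q^`() != 0.
  (* The coefficient of the derivative at [(size q).-2] is [(size q).-1] times the leading
     coefficient of [q]. *)
  apply/eqP => /polyP /(_ (size q).-2); rewrite coef_deriv coef0.
  have -> : (size q).-2.+1 = (size q).-1 by case: (size q) q1 => [|[]].
  rewrite -mulr_natr => /eqP; rewrite mulf_eq0 lead_coef_eq0 (negPf q0) /=.
  by case: (size q) q1 => [|[|m]] //= _; rewrite (negPf (char0 m)).
apply: contraT; rewrite /coprimep => /irr/(_ (dvdp_gcdl _ _)) E.
have := dvdp_leq dq0 (dvdp_gcdr q q^`()).
by rewrite (eqp_size E) leqNgt lt_size_deriv.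
Qed.

(** Since [p] itself may have only multiple roots, an irreducible factor over the fraction field is
    used; it is separable, and [K] adjoins one of its roots. Clearing denominators by [b] in the
    factor and by [a] in the cofactor gives [Q], [U] and [c = a * b]. *)
Lemma simple_root_extension (C : idomainType) (p : {poly C}) :
  (forall n, n.+1%:R != 0 :> C) -> (1 < size p)%N ->
  exists (Q U : {poly C}) (c : C) (K : fieldType) (iota : {rmorphism C -> K})
    (rho : K), [/\ c != 0, c *: p = Q * U, injective iota,
      (map_poly iota Q).[rho] = 0 & (map_poly iota Q^`()).[rho] != 0].
Proof.
move=> char0 p1; pose tau := @tofrac C.
have tau_inj : injective tau by move=> x y /eqP; rewrite tofrac_eq => /eqP.
have [|q irr qp] := @irreducible_factor _ (map_poly tau p).
  by rewrite size_map_inj_poly // rmorph0.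
have char0F n : n.+1%:R != 0 :> {fraction C}.
  by rewrite -(rmorph_nat tau) tofrac_eq0.
have sep := irreducible_separable char0F irr.
have /dvdpP [u Eu] := qp.
have [b b0 [Q EQ]] := poly_denom q; have [a a0 [U EU]] := poly_denom u.
have [L _ [rho root_rho _]] := irredp_FAdjoin irr.
pose iota : {rmorphism C -> L} := in_alg L \o tau.
have mapE (r : {poly C}) : map_poly iota r =
  map_poly (in_alg L) (map_poly tau r).
  by rewrite -map_poly_comp.
have tb0 : in_alg L (tau b) != 0 by rewrite fmorph_eq0 tofrac_eq0.
exists Q, U, (a * b), L, iota, rho; split.
- exact: mulf_neq0.
- apply: (map_inj_poly tau_inj (rmorph0 _)).
  rewrite [RHS]rmorphM /= -EQ -EU map_polyZ Eu -scalerAl -scalerAr scalerA.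
  rewrite [q * u]mulrC; congr (_ *: _); rewrite mulrC; exact: rmorphM.
- by move=> x y /fmorph_inj /tau_inj.
- rewrite mapE -EQ map_polyZ hornerZ; move/rootP: root_rho => ->.
  by rewrite mulr0.
- rewrite mapE -deriv_map -EQ derivZ map_polyZ hornerZ mulf_neq0 //.
  apply: contraTneq root_rho => E; apply/negP => /rootP root_rho.
  (* A Bezout relation between [q] and its derivative, evaluated at a common root [rho], would give
     0 = 1. *)
  have /Bezout_eq1_coprimepP [[r s] /= /(congr1 (map_poly (in_alg L)))] := sep.
  rewrite rmorphD !rmorphM rmorph1 /= => /(congr1 (horner^~ rho)).
  by rewrite /= hornerD !hornerM root_rho E !mulr0 addr0 hornerC => /eqP;
    rewrite eq_sym oner_eq0.
Qed.

(** * Differential polynomials in one unknown function *)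

Definition jets_idx n : choiceType := ('I_n + multinom n)%type.

Section Jets.
Variables (k : fieldType) (n : nat) (J : comAlgType k) (X : jets_idx n -> J).
Hypothesis HX : is_polyalg X.
Local Notation q i := (X (inl i)).
Local Notation T al := (X (inr al)).

(** The total derivative along the coordinate [q i], with the unknown function depending on all
    coordinates. *)
Definition jet_der (i : 'I_n) : J -> J :=
  poly_der HX (fun x =>
    match x with
    | inl j => (i == j)%:R
    | inr al => T (al + U_(i))%MM
    end).
Local Notation d := jet_der.

Lemma jet_derP i : is_derivation (d i).
Proof. exact: poly_derP. Qed.

Lemma jet_der_pos i j : d i (q j) = (i == j)%:R.
Proof. exact: poly_derX. Qed.

Lemma jet_der_jet i al : d i (T al) = T (al + U_(i))%MM.
Proof. exact: poly_derX. Qed.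

Lemma jet_derC i j x : d i (d j x) = d j (d i x).
Proof.
move: x; apply: (der_commute (polyalg_gen HX)
  (jet_derP i) (jet_derP j)) => -[l|al].
- rewrite !jet_der_pos.
  by case: (j == l); case: (i == l);
    rewrite ?(der_1 (jet_derP _)) ?(der_0 (jet_derP _)).
- by rewrite !jet_der_jet -!addmA [(U_(j) + _)%MM]addmC.
Qed.

(** Higher-order operators are indexed by words, which suits induction on the order; as the
    derivations commute, only the multi-index [content w] matters. *)
Definition jet_ders (w : seq 'I_n) (x : J) : J := foldl (fun y i => d i y) x w.

Lemma jet_ders_rcons w i x : jet_ders (rcons w i) x = d i (jet_ders w x).
Proof. by rewrite /jet_ders -cats1 foldl_cat. Qed.

Lemma jet_ders_cat w w' x : jet_ders (w ++ w') x = jet_ders w' (jet_ders w x).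
Proof. by rewrite /jet_ders foldl_cat. Qed.

Lemma jet_dersD w x y : jet_ders w (x + y) = jet_ders w x + jet_ders w y.
Proof.
elim: w x y => //= i w IH x y.
by rewrite (der_add _ _ (jet_derP _)) IH.
Qed.

Lemma jet_dersZ w (a : k) x : jet_ders w (a *: x) = a *: jet_ders w x.
Proof.
elim: w x => //= i w IH x.
by rewrite (der_scale _ _ (jet_derP _)) IH.
Qed.

Lemma jet_ders_perm w w' x : perm_eq w w' -> jet_ders w x = jet_ders w' x.
Proof.
have comm1 i v y : jet_ders v (d i y) = d i (jet_ders v y).
  by elim: v y => //= j v IH y; rewrite jet_derC IH.
have comm u v y : jet_ders u (jet_ders v y) = jet_ders v (jet_ders u y).
  by elim: u y => //= i u IH y; rewrite -comm1 IH.
move=> ww'; pose P v := jet_ders w x = jet_ders v x.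
apply: (catCA_perm_ind (P := P) _ ww') => //.
by move=> s1 s2 s3; rewrite /P => ->; rewrite !jet_ders_cat (comm s1 s2).
Qed.

Definition content (w : seq 'I_n) : multinom n :=
  [multinom count_mem i w | i < n].

Lemma content_perm w w' : content w = content w' -> perm_eq w w'.
Proof.
move=> E; apply/allP => i _ /=.
by have := congr1 (fun al : multinom n => al i) E; rewrite !mnmE => ->.
Qed.

Lemma content_rcons w i : content (rcons w i) = (content w + U_(i))%MM.
Proof.
apply/mnmP => j; rewrite mnmDE mnm1E !mnmE -cats1 count_cat /=.
by rewrite addn0.
Qed.

(** The ranking is the graded monomial order on multi-indices: total, well-founded and compatible
    with addition. The coordinates rank below every derivative of the unknown. *)
Definition jets_below (th : multinom n) (x : jets_idx n) : Prop :=
  match x with inl _ => True | inr al => (al < th)%O end.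
Definition jets_upto (th : multinom n) (x : jets_idx n) : Prop :=
  match x with inl _ => True | inr al => (al <= th)%O end.
Definition jets_none (x : jets_idx n) : Prop :=
  match x with inl _ => True | inr _ => False end.

Lemma below_jet th al : (al < th)%O -> polyvars X (jets_below th) (T al).
Proof. by move=> lt; apply: polyvarsX. Qed.

Lemma upto_below th th' x : (th < th')%O ->
  polyvars X (jets_upto th) x -> polyvars X (jets_below th') x.
Proof.
move=> lt; apply: polyvars_mono => -[//|al] /= le;
  exact: Order.POrderTheory.le_lt_trans lt.
Qed.

Lemma ltm_addU (th : multinom n) i : (th < (th + U_(i))%MM)%O.
Proof. by apply: lt_mdeg_ltmc; rewrite mdegD mdeg1 addn1. Qed.

Lemma below_der th i x : polyvars X (jets_below th) x ->
  polyvars X (jets_below (th + U_(i))%MM) (d i x).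
Proof.
apply: polyvars_der => [|[//|al] /= lt|[j _|al /= lt]]; first exact: jet_derP.
- exact: Order.POrderTheory.lt_trans (ltm_addU _ _).
- rewrite jet_der_pos; case: (i == j); [exact: subalg_1 | exact: subalg_0].
- by rewrite jet_der_jet; apply: polyvarsX;
    rewrite /= [(al + _)%MM]addmC [(th + _)%MM]addmC ltmc_add2r.
Qed.

Lemma upto_der th i x : polyvars X (jets_upto th) x ->
  polyvars X (jets_upto (th + U_(i))%MM) (d i x).
Proof.
apply: polyvars_der => [|[//|al] /= lt|[j _|al /= lt]]; first exact: jet_derP.
- apply/Order.POrderTheory.ltW.
  exact: Order.POrderTheory.le_lt_trans (ltm_addU _ _).
- rewrite jet_der_pos; case: (i == j); [exact: subalg_1 | exact: subalg_0].
- by rewrite jet_der_jet; apply: polyvarsX;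
    rewrite /= [(al + _)%MM]addmC [(th + _)%MM]addmC lemc_add2r.
Qed.

(** Finitely many jets occur in [y], so some bound [th] exists. If [y] lies strictly below [th], the
    largest jet of a finite list of variables for [y] is a smaller bound, and it exists because [y]
    is not a polynomial in the coordinates alone. Well-founded descent ends at the leader. *)
Lemma leader_exists y : ~ polyvars X jets_none y ->
  exists2 th, polyvars X (jets_upto th) y & ~ polyvars X (jets_below th) y.
Proof.
move=> yN.
have below_lt th : polyvars X (jets_below th) y ->
    exists2 th', (th' < th)%O & polyvars X (jets_upto th') y.
  move=> /polyvars_finite [s sth sy].
  have [sN|[th' lt sth']] : (forall x, x \in s -> jets_none x) \/
      exists2 th', (th' < th)%O & forall x, x \in s -> jets_upto th' x.
  - elim: s sth {sy} => [|x s IH] sth; first by left.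
    have [|IHN|[th' lt IHth]] := IH.
    + by move=> z zs; apply: sth; rewrite inE zs orbT.
    + case: x sth => [i|al] sth.
        by left=> z; rewrite inE => /orP [/eqP ->|/IHN].
      right; exists al; first by apply: (sth (inr al)); rewrite inE eqxx.
      move=> z; rewrite inE => /orP [/eqP -> //=|/IHN].
      by case: z.
    + right; case: x sth => [i|al] sth.
        exists th' => // z; rewrite inE => /orP [/eqP -> //|/IHth//].
      have alth : (al < th)%O by apply: (sth (inr al)); rewrite inE eqxx.
      exists (Order.max al th'); first by rewrite Order.TotalTheory.gt_max alth.
      move=> z; rewrite inE => /orP [/eqP ->|/IHth] /=.
        by rewrite Order.TotalTheory.le_max Order.POrderTheory.lexx.
      by case: z => //= be; rewrite Order.TotalTheory.le_max orbC => ->.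
  - by case: yN; apply: polyvars_mono sy.
  - by exists th' => //; apply: polyvars_mono sy.
have [th0 y0] : exists th, polyvars X (jets_upto th) y.
  have [s _ sy] := polyvars_finite (polyvars_all HX y).
  have [th sth] : exists th, forall x, x \in s -> jets_upto th x.
    elim: s {sy} => [|x s [th IH]]; first by exists 0%MM.
    case: x => [i|al].
      by exists th => z; rewrite inE => /orP [/eqP ->|/IH].
    exists (Order.max al th) => z; rewrite inE => /orP [/eqP ->|/IH] /=.
      by rewrite Order.TotalTheory.le_max Order.POrderTheory.lexx.
    by case: z => //= be; rewrite Order.TotalTheory.le_max orbC => ->.
  by exists th; apply: polyvars_mono sy.
move: th0 y0; apply: (ltmwf (P := fun th => polyvars X (jets_upto th) y -> _)).
move=> th IH yth.
case: (pselect (polyvars X (jets_below th) y)) => [/below_lt [th' lt y']|H].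
  exact: IH lt y'.
by exists th.
Qed.

End Jets.

(** * Polynomials in finitely many of the variables *)

Lemma mpoly_rmorph_eq (k : fieldType) r (S : comNzRingType)
    (phi psi : {rmorphism mpoly r k -> S}) :
  (forall a, phi (mpolyC r a) = psi (mpolyC r a)) ->
  (forall i, phi ('X_i)%R = psi ('X_i)%R) -> phi =1 psi.
Proof.
move=> EC EX p; rewrite (mpolyE p) !rmorph_sum; apply: eq_bigr => u _.
rewrite -mul_mpolyC !rmorphM EC; congr (_ * _).
rewrite mpolyXE_id !rmorph_prod; apply: eq_bigr => i _.
by rewrite !rmorphXn EX.
Qed.

Section FinitelyManyVariables.
Variables (k : fieldType) (I : choiceType) (A : comAlgType k) (X : I -> A).
Variable s : seq I.
Local Notation C := (mpoly (size s) k).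

(** The ring [C] is known to be an integral domain, whereas [A] is only a commutative algebra;
    elements of [A] are pulled back to [C] in order to form a fraction field. *)
Definition mpoly_sub : {rmorphism C -> A} :=
  mpoly.mmap (in_alg A) (fun j => X (tnth (in_tuple s) j)).

Lemma mpoly_subC a : mpoly_sub (mpolyC _ a) = a%:A.
Proof. by rewrite /mpoly_sub /= mmapC. Qed.

Lemma mpoly_subX j : mpoly_sub ('X_j)%R = X (tnth (in_tuple s) j).
Proof. by rewrite /mpoly_sub /= mmapX mmap1U. Qed.

Lemma mpoly_sub_polyvars p : polyvars X (fun i => i \in s) (mpoly_sub p).
Proof.
rewrite (mpolyE p) rmorph_sum; apply: subalg_sum => u.
rewrite -mul_mpolyC rmorphM mpoly_subC mulr_algl; apply: subalg_scale.
rewrite mpolyXE_id rmorph_prod; elim: (index_enum _) => [|j t IH].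
  by rewrite big_nil; apply: subalg_1.
rewrite big_cons; apply: subalg_mul => //; rewrite rmorphXn; apply: subalg_exp.
by rewrite mpoly_subX; apply: polyvarsX; apply: mem_tnth.
Qed.

Lemma polyvars_mpoly f : polyvars X (fun i => i \in s) f ->
  exists p, f = mpoly_sub p.
Proof.
elim=> {f} [|f [i si ->]|a f g _ [p ->] _ [p' ->]|f g _ [p ->] _ [p' ->]].
- by exists 1; rewrite rmorph1.
- have [j ->] := tnthP (in_tuple s) i si.
  by exists ('X_j)%R; rewrite mpoly_subX.
- by exists (mpolyC _ a * p + p'); rewrite rmorphD rmorphM mpoly_subC mulr_algl.
- by exists (p * p'); rewrite rmorphM.
Qed.

Definition poly_sub (x : A) : {rmorphism {poly C} -> A} :=
  horner_eval x \o map_poly mpoly_sub.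

Lemma poly_subE x p : poly_sub x p = (map_poly mpoly_sub p).[x].
Proof. by []. Qed.

Lemma poly_subC x c : poly_sub x c%:P = mpoly_sub c.
Proof. by rewrite poly_subE map_polyC hornerC. Qed.

Lemma polyvars_poly i f : polyvars X (fun j => j \in i :: s) f ->
  exists p, f = poly_sub (X i) p.
Proof.
elim=> {f} [|f [j sj ->]|a f g _ [p ->] _ [p' ->]|f g _ [p ->] _ [p' ->]].
- by exists 1; rewrite rmorph1.
- move: sj; rewrite inE => /orP [/eqP ->|sj].
    by exists 'X; rewrite poly_subE map_polyX hornerX.
  have [|p ->] := @polyvars_mpoly (X j); first exact: polyvarsX.
  by exists p%:P; rewrite poly_subC.
- exists ((mpolyC _ a)%:P * p + p').
  by rewrite rmorphD rmorphM poly_subC mpoly_subC mulr_algl.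
- by exists (p * p'); rewrite rmorphM.
Qed.

Lemma poly_sub_ev (K : comNzRingType) (phi : {rmorphism A -> K})
    (iota : {rmorphism C -> K}) x p :
  (forall a, phi a%:A = iota (mpolyC _ a)) ->
  (forall j, phi (X (tnth (in_tuple s) j)) = iota ('X_j)%R) ->
  phi (poly_sub x p) = (map_poly iota p).[phi x].
Proof.
move=> EC EX.
have E : (phi \o mpoly_sub) =1 iota.
  by apply: mpoly_rmorph_eq => [a|j] /=; rewrite ?mpoly_subC ?mpoly_subX.
rewrite poly_subE -horner_map -map_poly_comp; congr (_.[_]).
exact: eq_map_poly.
Qed.

End FinitelyManyVariables.

(** Recursion for a functional stated on total functions: here [F] will evaluate a polynomial at the
    point described by the whole function, although only smaller arguments influence the result. *)
Lemma wf_fixpoint (D K : Type) (R : D -> D -> Prop) (F : (D -> K) -> D -> K) :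
  well_founded R -> inhabited K ->
  (forall f g a, (forall b, R b a -> f b = g b) -> F f a = F g a) ->
  exists f, forall a, f a = F f a.
Proof.
move=> wfR [z] HF.
(* The default [z] fills the arguments not below [a], which [F] ignores by [HF]. *)
pose G a (rec : forall b, R b a -> K) : K :=
  F (fun b => if pselect (R b a) is left H then rec b H else z) a.
exists (Fix wfR (fun=> K) G) => a; rewrite Fix_eq.
  by apply: HF => b Rb; case: pselect.
move=> x f g E; apply: HF => b Rb; case: pselect => // H; exact: E.
Qed.

(** * Generic solutions of a differential equation *)

Section JetsZero.
Variables (k : fieldType) (n : nat) (J : comAlgType k) (X : jets_idx n -> J).
Hypothesis HX : is_polyalg X.
Local Notation q i := (X (inl i)).
Local Notation T al := (X (inr al)).
Local Notation d := (jet_der HX).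
Local Notation ders := (jet_ders HX).

Section Killed.
Variables (K : fieldType) (chi : {rmorphism J -> K}).

(** The largest ideal stable under all [d i] inside the kernel of [chi]. *)
Definition killed (x : J) : Prop := forall w, chi (ders w x) = 0.

Lemma killed_0 : killed 0.
Proof.
move=> w; have := jet_dersZ HX w 0 0; rewrite !scale0r => ->.
exact: rmorph0.
Qed.

Lemma killed_lin (a : k) x y : killed x -> killed y -> killed (a *: x + y).
Proof.
move=> Kx Ky w; rewrite jet_dersD jet_dersZ rmorphD Ky addr0.
by rewrite -[ders w x]mul1r scalerAl rmorphM Kx mulr0.
Qed.

Lemma killed_add x y : killed x -> killed y -> killed (x + y).
Proof. by move=> Kx Ky; rewrite -[x]scale1r; apply: killed_lin. Qed.

Lemma killed_sum (I : Type) (r : seq I) (F : I -> J) :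
  (forall i, killed (F i)) -> killed (\sum_(i <- r) F i).
Proof.
move=> KF; elim: r => [|i r IH]; first by rewrite big_nil; apply: killed_0.
by rewrite big_cons; apply: killed_add.
Qed.

Lemma killed_der i x : killed x -> killed (d i x).
Proof. by move=> Kx w; apply: (Kx (i :: w)). Qed.

Lemma killed_mul x y : killed y -> killed (x * y).
Proof.
move=> Ky w; elim: w x y Ky => [|i w IH] x y Ky /=.
  by rewrite rmorphM (Ky [::]) mulr0.
rewrite (der_mul (jet_derP HX i)) jet_dersD rmorphD !IH ?addr0 //.
exact: killed_der.
Qed.

(** Induction on the order [m]: once all derivatives of [y] of order below [m] are killed, the only
    surviving Leibniz term of an order [m] derivative of [x * y] is [x] times that derivative of
    [y], and [chi x] cancels. *)
Lemma killed_cancel x y : killed (x * y) -> chi x != 0 -> killed y.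
Proof.
move=> Kxy x0.
pose Kn m z := forall w, (size w < m)%N -> chi (ders w z) = 0.
have Kder m i z : Kn m.+1 z -> Kn m (d i z).
  by move=> Kz w lt; apply: (Kz (i :: w)).
have Kmul m u z : Kn m z -> Kn m (u * z).
  move=> Kz w; elim: w m u z Kz => [|i w IH] m u z Kz /=.
    by case: m Kz => // m /(_ [::] isT) /= Kz _; rewrite rmorphM Kz mulr0.
  case: m Kz => // m Kz; rewrite ltnS => lt.
  rewrite (der_mul (jet_derP HX i)) jet_dersD rmorphD.
  rewrite (IH m) ?add0r ?(IH m) //; first exact: Kder.
  by move=> v lv; apply: Kz; apply: ltn_trans lv _.
have Kstep m z w : Kn m z -> size w = m ->
    chi (ders w (x * z)) = chi x * chi (ders w z).
  move=> Kz sw; move: Kz; rewrite -{m}sw; elim: w z => [|i w IH] z Kz /=;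
    first by rewrite rmorphM.
  rewrite (der_mul (jet_derP HX i)) jet_dersD rmorphD IH; last exact: Kder.
  by rewrite (Kmul _ _ _ Kz) ?add0r.
suff H m : Kn m y by move=> w; apply: (H (size w).+1).
elim: m => // m IH w; rewrite ltnS leq_eqVlt => /orP [/eqP sw|/IH //].
have := Kstep m y w IH sw; rewrite Kxy => /esym/eqP.
by rewrite mulf_eq0 (negPf x0) /= => /eqP.
Qed.

End Killed.

(** The chain rule: the new leading derivative appears linearly with the separant as coefficient,
    and differentiating the coefficients of [p] produces only lower jets. *)
Lemma jet_lead (s : seq (jets_idx n)) th i p :
  (forall x, x \in s -> jets_below th x) ->
  exists2 h, polyvars X (jets_below (th + U_(i))%MM) h &
    d i (poly_sub X s (T th) p) =
      poly_sub X s (T th) p^`() * T (th + U_(i))%MM + h.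
Proof.
move=> sth; elim/poly_ind: p => [|p c [h Bh Eh]].
  exists 0; first exact: subalg_0.
  by rewrite deriv0 rmorph0 mul0r addr0 (der_0 (jet_derP HX i)).
exists (h * T th + d i (mpoly_sub X s c)).
  apply: subalg_add.
    by apply: subalg_mul => //; apply: below_jet; apply: ltm_addU.
  apply: below_der; apply: polyvars_mono (mpoly_sub_polyvars X c) => x;
    exact: sth.
rewrite derivD derivM derivX derivC addr0 mulr1 !rmorphD !rmorphM poly_subC.
have -> : poly_sub X s (T th) 'X = T th.
  by rewrite poly_subE map_polyX hornerX.
rewrite (der_add _ _ (jet_derP HX i)) (der_mul (jet_derP HX i)) Eh.
rewrite jet_der_jet; ring.
Qed.

(** After one derivation the leading term is linear, and further derivations keep the same separant
    as its coefficient. *)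
Lemma jet_leads (s : seq (jets_idx n)) th w p :
  (forall x, x \in s -> jets_below th x) -> w != [::] ->
  exists2 h, polyvars X (jets_below (th + content w)%MM) h &
    ders w (poly_sub X s (T th) p) =
      poly_sub X s (T th) p^`() * T (th + content w)%MM + h.
Proof.
move=> sth; elim/last_ind: w => // w i IH _.
have content0 : content [::] = 0%MM :> multinom n.
  by apply/mnmP => j; rewrite !mnmE.
rewrite content_rcons jet_ders_rcons.
have [->|w0] := eqVneq w [::].
  by rewrite content0 add0m; apply: jet_lead.
have [h Bh ->] := IH w0.
(* Strictness comes from [w] being nonempty; it puts the derivative of the separant, and the old
   leader that it multiplies, below the new leader. *)
have lt : (th < (th + content w)%MM)%O.
  case/lastP: w w0 {IH Bh} => // w j _; rewrite content_rcons addmA.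
  exact: Order.POrderTheory.le_lt_trans (lemc_addr _ _) (ltm_addU _ _).
have Bs : polyvars X (jets_upto th) (poly_sub X s (T th) p^`()).
  rewrite poly_subE horner_coef; apply: subalg_sum => j.
  apply: subalg_mul.
    rewrite coef_map; apply: polyvars_mono (mpoly_sub_polyvars X _) => x /sth.
    by case: x => //= al; apply: Order.POrderTheory.ltW.
  by apply/subalg_exp/polyvarsX => /=.
exists (d i (poly_sub X s (T th) p^`()) * T (th + content w)%MM + d i h).
  rewrite addmA; apply: subalg_add; last exact: below_der.
  apply: subalg_mul; last by apply: below_jet; apply: ltm_addU.
  apply: upto_below (upto_der _ _ Bs).
  by rewrite ![(_ + U_(i))%MM]addmC ltmc_add2r.
rewrite (der_add _ _ (jet_derP HX i)) (der_mul (jet_derP HX i)).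
by rewrite jet_der_jet -addmA; ring.
Qed.

Lemma jets_zero y g : (forall m, m.+1%:R != 0 :> k) ->
  ~ polyvars X (@jets_none n) y -> polyvars X (@jets_none n) g -> g != 0 ->
  exists (K : fieldType) (chi : {rmorphism J -> K}),
    killed chi y /\ chi g != 0.
Proof.
move=> char0 yN gN g0.
have [th yth nyth] := leader_exists HX yN.
have [s0 s0th ys0] := polyvars_finite yth.
have [s1 s1N gs1] := polyvars_finite gN.
(* The variables of [y] other than its leader, together with those of [g], so that [g] is also a
   coefficient. Removing duplicates lets [v0] find the position of a variable. *)
pose s := undup ([seq x <- s0 | x != inr th] ++ s1).
have sth x : x \in s -> jets_below th x.
  rewrite mem_undup mem_cat mem_filter => /orP [/andP [xth /s0th]|/s1N].
    case: x xth => //= al; rewrite Order.POrderTheory.le_eqVlt => alth.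
    by case/orP => // /eqP E; rewrite E eqxx in alth.
  by case: x.
have [p Ep] : exists p, y = poly_sub X s (T th) p.
  apply: polyvars_poly; apply: polyvars_mono ys0 => x xs0.
  rewrite inE mem_undup mem_cat mem_filter xs0 andbT.
  by case: eqP.
have [G EG] : exists G, g = mpoly_sub X s G.
  apply: polyvars_mpoly; apply: polyvars_mono gs1 => x xs1.
  by rewrite mem_undup mem_cat xs1 orbT.
(* A constant [p] would put [y] below its leader. *)
have p1 : (1 < size p)%N.
  rewrite ltnNge; apply/negP => /size1_polyC E; apply: nyth.
  rewrite Ep E poly_subC; apply: polyvars_mono (mpoly_sub_polyvars X _) => x.
  exact: sth.
have char0C m : m.+1%:R != 0 :> mpoly (size s) k.
  by rewrite -(rmorph_nat (@mpolyC (size s) k)) mpolyC_eq0.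
have [Q [U [c [K [iota [rho [c0 EQ iota_inj rootQ rootQ']]]]]]] :=
  simple_root_extension char0C p1.
pose sigma : {rmorphism k -> K} := iota \o @mpolyC (size s) k.
pose S1 := poly_sub X s (T th) Q^`().
(* The lower-order part depends only on the multi-index reached: words with equal content are
   permutations of each other and give the same derivative. At indices not reached by a nonempty
   word, [h] is 0. *)
have [h Bh Eh] : exists2 h : multinom n -> J,
    forall al, polyvars X (jets_below al) (h al) &
    forall w, w != [::] -> ders w (poly_sub X s (T th) Q) =
      S1 * T (th + content w)%MM + h (th + content w)%MM.
  have H al : exists h, polyvars X (jets_below al) h /\
      forall w, w != [::] -> al = (th + content w)%MM ->
      ders w (poly_sub X s (T th) Q) = S1 * T al + h.
    case: (pselect (exists2 w, w != [::] & al = (th + content w)%MM)).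
      case=> w w0 ->; have [h Bh Eh] := jet_leads Q sth w0.
      exists h; split=> // w' w'0 /addmI /content_perm ww'.
      by rewrite -(jet_ders_perm HX _ ww').
    move=> H; exists 0; split=> [|w w0 E]; first exact: subalg_0.
    by case: H; exists w.
  have [h Hh] := choice H; exists h => [al|w w0]; first by case: (Hh al).
  by case: (Hh (th + content w)%MM) => _; apply.
(* Variables of [s] get their generic value; for those outside [s] the value is free and set to
   0. *)
pose v0 x : K := if insub (index x s) is Some j then iota ('X_j)%R else 0.
have v0E j : v0 (tnth (in_tuple s) j) = iota ('X_j)%R.
  rewrite /v0 (tnth_nth (tnth (in_tuple s) j)) index_uniq ?undup_uniq //.
  by rewrite valK.
pose v (f : multinom n -> K) (x : jets_idx n) : K :=
  match x with inl i => v0 (inl i) | inr al => f al end.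
pose ev f := poly_ev HX sigma (v f).
have evE f f' al z : polyvars X (jets_below al) z ->
    (forall be, (be < al)%O -> f be = f' be) -> ev f z = ev f' z.
  move=> Bz ff'; apply: polyvars_ev Bz => -[//|be] /=; exact: ff'.
(* Values of the jets: given below the leader, the root [rho] at the leader, and above it the
   solution of the linear equation with coefficient [S1]. The recursion is well-founded because
   [h al] and, for [al] above [th], [S1] involve only jets below [al]. *)
have [f Ef] : exists f : multinom n -> K, forall al, f al =
    if (al < th)%O then v0 (inr al) else
    if (al == th) then rho else - ev f (h al) / ev f S1.
  apply: (wf_fixpoint (R := fun be al : multinom n => (be < al)%O)
    (F := fun f al => if (al < th)%O then v0 (inr al) else
      if (al == th) then rho else - ev f (h al) / ev f S1)).
  - exact: ltom_wf.
  - by split; exact: 0.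
  move=> f f' al ff'; case: ifP => // /negbT lt1; case: eqVneq => // ne.
  have alth : (th < al)%O.
    by rewrite Order.POrderTheory.lt_neqAle eq_sym ne Order.TotalTheory.leNgt.
  rewrite (evE f f' al (h al)) // (evE f f' al S1) //.
  apply: (upto_below alth); rewrite /S1 poly_subE horner_coef;
    apply: subalg_sum => j.
  apply: subalg_mul; last by apply/subalg_exp/polyvarsX => /=.
  rewrite coef_map; apply: polyvars_mono (mpoly_sub_polyvars X _) => x /sth.
  by case: x => //= be; apply: Order.POrderTheory.ltW.
pose chi := ev f.
have chiC a : chi a%:A = iota (mpolyC _ a) by rewrite /chi /ev poly_evC.
have chiX j : chi (X (tnth (in_tuple s) j)) = iota ('X_j)%R.
  rewrite /chi /ev poly_evX -v0E; have := sth _ (mem_tnth j (in_tuple s)).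
  case: (tnth _ j) => //= al alth; by rewrite Ef alth.
have chiT : chi (T th) = rho.
  by rewrite /chi /ev poly_evX /= Ef Order.POrderTheory.ltxx eqxx.
have chi_sub r : chi (poly_sub X s (T th) r) = (map_poly iota r).[rho].
  by rewrite -chiT; apply: poly_sub_ev.
have S1n0 : chi S1 != 0 by rewrite chi_sub.
have killQ : killed chi (poly_sub X s (T th) Q).
  move=> w; have [->|w0] := eqVneq w [::]; first by rewrite /= chi_sub.
  have lt : (th < (th + content w)%MM)%O.
    case/lastP: w w0 => // w j _; rewrite content_rcons addmA.
    exact: Order.POrderTheory.le_lt_trans (lemc_addr _ _) (ltm_addU _ _).
  rewrite Eh // rmorphD rmorphM [chi (T _)]poly_evX /= Ef.
  rewrite Order.POrderTheory.lt_gtF // Order.POrderTheory.gt_eqF //.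
  by rewrite mulrC mulfVK // addNr.
exists K, chi; split; last first.
  rewrite EG -(poly_subC X (T th)) chi_sub map_polyC hornerC.
  rewrite -(rmorph0 iota) (inj_eq iota_inj).
  by apply: contraNneq g0 => G0; rewrite EG G0 rmorph0.
(* Here [c] times [y] is [Q] times [U] evaluated at the leader, hence killed; [c] is nonzero under
   [chi] since [iota] is injective. *)
apply: (killed_cancel (x := mpoly_sub X s c)); last first.
  rewrite -(poly_subC X (T th)) chi_sub map_polyC hornerC.
  by rewrite -(rmorph0 iota) (inj_eq iota_inj).
rewrite Ep -(poly_subC X (T th)) -rmorphM mul_polyC EQ rmorphM mulrC.
exact: killed_mul.
Qed.

End JetsZero.

(** * The Dynkin operator *)

Section Dynkin.
Variables (k : fieldType) (X : eqType).
Local Notation L := (free_lie k X).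
Local Notation z := (@fl_gen k X).

Inductive lie_monomial : nat -> L -> Prop :=
  | lie_monomial_gen x : lie_monomial 1 (z x)
  | lie_monomial_br m n u v : lie_monomial m u -> lie_monomial n v ->
      lie_monomial (m + n) (lieb u v).

Lemma lie_monomial_gt0 n v : lie_monomial n v -> (0 < n)%N.
Proof. by elim=> // m p u w _ IHm _ _; rewrite addn_gt0 IHm. Qed.

(** The linear span of the bracket monomials contains the generators and is closed under brackets,
    so it is the whole free Lie algebra. *)
Lemma lie_monomial_span_ind (Q : L -> Prop) :
  (forall n v, lie_monomial n v -> Q v) -> Q 0 ->
  (forall (a : k) u v, Q u -> Q v -> Q (a *: u + v)) -> forall v, Q v.
Proof.
move=> QM Q0 Ql v.
(* [S] is that span, encoded by its induction principle. *)
pose S (u : L) := forall R : L -> Prop, R 0 ->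
  (forall n (a : k) x y, lie_monomial n x -> R y -> R (a *: x + y)) -> R u.
suff Sv : S v by apply: Sv => // n a x y /QM; exact: Ql.
have Slin (a : k) x y : S x -> S y -> S (a *: x + y).
  move=> Sx Sy R R0 Rl; apply: (Sx (fun x => R (a *: x + y))).
    by rewrite scaler0 add0r; apply: Sy.
  move=> n b x' y' Mx' Ry'; rewrite scalerDr scalerA -addrA; exact: Rl Mx' Ry'.
have S0 : S 0 by [].
have Smon n x : lie_monomial n x -> S x.
  by move=> Mx R R0 Rl; have := Rl n 1 x 0 Mx R0; rewrite scale1r addr0.
have Sbr x y : S x -> S y -> S (lieb x y).
  move=> Sx Sy; apply: (Sx (fun x => S (lieb x y))); first by rewrite lieb0l.
  move=> n a u x' Mu IHx; rewrite lieb_linearl; apply: (Slin) => //.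
  apply: (Sy (fun y => S (lieb u y))); first by rewrite lieb0r.
  move=> p b w y' Mw IHy; rewrite lieb_linearr; apply: (Slin) => //.
  exact: Smon (lie_monomial_br Mu Mw).
by apply: free_lie_ind => // x; apply: Smon (lie_monomial_gen x).
Qed.

Definition ad_word (w : seq X) (u : L) : L :=
  foldr (fun x y => lieb (z x) y) u w.

Fixpoint dynkin (w : seq X) : L :=
  match w with
  | [::] => 0
  | x :: w' => if nilp w' then z x else lieb (z x) (dynkin w')
  end.

Lemma dynkin_cat w w' : ~~ nilp w' ->
  dynkin (w ++ w') = ad_word w (dynkin w').
Proof.
move=> w'0; elim: w => //= x w ->; case: ifP => //.
by rewrite /nilp size_cat addn_eq0 => /andP [_ /negPn]; rewrite w'0.
Qed.

Lemma ad_word_cat w w' u : ad_word (w ++ w') u = ad_word w (ad_word w' u).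
Proof. exact: foldr_cat. Qed.

Lemma ad_word_linear w (a : k) u v :
  ad_word w (a *: u + v) = a *: ad_word w u + ad_word w v.
Proof. by elim: w => //= x w ->; rewrite lieb_linearr. Qed.

Lemma ad_word0 w : ad_word w 0 = 0.
Proof. by elim: w => //= x w ->; rewrite lieb0r. Qed.

Lemma ad_word_sum w (s : seq (k * seq X)) (F : seq X -> L) :
  ad_word w (\sum_(p <- s) p.1 *: F p.2) =
    \sum_(p <- s) p.1 *: ad_word w (F p.2).
Proof.
elim: s => [|p s IH]; first by rewrite !big_nil ad_word0.
by rewrite !big_cons ad_word_linear IH.
Qed.

Variables (B : poissonAlgType k) (h : L -> B) (q : seq X -> B).
Hypothesis hL : forall u v, h (lieb u v) = lieb (h u) (h v).
Hypothesis hX : forall x, h (z x) = q [:: x].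
Hypothesis qL : forall u v, lieb (q u) (q v) = q (u ++ v) - q (v ++ u).

Definition cat_terms (s t : seq (k * seq X)) : seq (k * seq X) :=
  [seq (x.1 * y.1, x.2 ++ y.2) | x <- s, y <- t].

Lemma sum_cat_terms (V : lmodType k) (F : seq X -> V) s t :
  \sum_(p <- cat_terms s t) p.1 *: F p.2 =
    \sum_(x <- s) x.1 *: \sum_(y <- t) y.1 *: F (x.2 ++ y.2).
Proof.
rewrite /cat_terms big_allpairs_dep /=; apply: eq_bigr => x _;
  rewrite scaler_sumr.
by apply: eq_bigr => y _; rewrite scalerA.
Qed.

(* [s] is the expansion of [v] in the free associative algebra. *)
Lemma lie_monomial_words n v : lie_monomial n v ->
  exists s : seq (k * seq X),
    [/\ {in s, forall p, size p.2 = n},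
        forall u, \sum_(p <- s) p.1 *: ad_word p.2 u = lieb v u,
        \sum_(p <- s) p.1 *: dynkin p.2 = n%:R *: v
      & \sum_(p <- s) p.1 *: q p.2 = h v].
Proof.
elim=> {n v} [x|m n u v Mu [s [sz adE dE qE]] Mv [t [sz' adE' dE' qE']]].
  exists [:: (1, [:: x])]; split=> [p|u||]; rewrite ?big_seq1 ?scale1r //=.
    by rewrite inE => /eqP ->.
pose opp (r : seq (k * seq X)) := [seq (- p.1, p.2) | p <- r].
have sum_comm (V : lmodType k) (F : seq X -> V) :
    \sum_(p <- cat_terms s t ++ opp (cat_terms t s)) p.1 *: F p.2 =
    \sum_(x <- s) x.1 *: (\sum_(y <- t) y.1 *: F (x.2 ++ y.2)) -
    \sum_(y <- t) y.1 *: (\sum_(x <- s) x.1 *: F (y.2 ++ x.2)).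
  rewrite big_cat /= !sum_cat_terms; congr (_ + _).
  rewrite big_map -[X in - X]sum_cat_terms -sumrN.
  by apply: eq_bigr => p _; rewrite scaleNr.
have lieb_sum (V : lieAlgType k) (F G : seq X -> V) (s1 t1 : seq (k * seq X)) :
    lieb (\sum_(x <- s1) x.1 *: F x.2) (\sum_(y <- t1) y.1 *: G y.2) =
    \sum_(x <- s1) x.1 *: \sum_(y <- t1) y.1 *: lieb (F x.2) (G y.2).
  elim: s1 => [|x s1 IH]; first by rewrite !big_nil lieb0l.
  rewrite !big_cons lieb_linearl IH; congr (_ *: _ + _) => {IH}.
  elim: t1 => [|y t1 IH]; first by rewrite !big_nil lieb0r.
  by rewrite !big_cons lieb_linearr IH.
have m0 := lie_monomial_gt0 Mu; have n0 := lie_monomial_gt0 Mv.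
exists (cat_terms s t ++ opp (cat_terms t s)); split.
- move=> p; rewrite mem_cat => /orP [/allpairsP [[x y] /= [xs yt ->]] /=|].
    by rewrite size_cat sz ?sz'.
  move=> /mapP [p' /allpairsP [[x y] /= [xs yt ->]] ->] /=.
  by rewrite size_cat sz' ?sz // addnC.
(* Letters act by [ad], so products act by composition and the commutator acts as [lieb u v], by the
   Jacobi identity. *)
- have E s1 t1 u1 v1 x :
      (forall w, \sum_(p <- s1) p.1 *: ad_word p.2 w = lieb u1 w) ->
      (forall w, \sum_(p <- t1) p.1 *: ad_word p.2 w = lieb v1 w) ->
      \sum_(y <- s1) y.1 *: (\sum_(w <- t1) w.1 *: ad_word (y.2 ++ w.2) x) =
        lieb u1 (lieb v1 x).
    move=> H1 H2; rewrite -H1; apply: eq_bigr => y _; rewrite -H2.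
    congr (_ *: _); rewrite (ad_word_sum _ _ (ad_word^~ x)).
    by apply: eq_bigr => w _; rewrite ad_word_cat.
  move=> x; rewrite (sum_comm _ (ad_word^~ x)) lieb_ad.
  by rewrite (E _ _ _ _ _ adE adE') (E _ _ _ _ _ adE' adE).
(* The Dynkin-Specht-Wever argument: the left factor acts by [ad] on the bracketing of the right
   one, which by induction is its degree times itself. Hence the commutator gives n [u, v] - m
   [v, u] = (m + n) [u, v]. *)
- have E s1 t1 (n1 : nat) u1 v1 : (0 < n1)%N ->
      {in t1, forall p, size p.2 = n1} ->
      (forall w, \sum_(p <- s1) p.1 *: ad_word p.2 w = lieb u1 w) ->
      \sum_(p <- t1) p.1 *: dynkin p.2 = n1%:R *: v1 ->
      \sum_(y <- s1) y.1 *: (\sum_(w <- t1) w.1 *: dynkin (y.2 ++ w.2)) =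
        n1%:R *: lieb u1 v1.
    move=> n10 S1 H1 H2.
    have -> : n1%:R *: lieb u1 v1 = lieb u1 (n1%:R *: v1).
      by have := lieb_linearr n1%:R v1 0 u1; rewrite lieb0r !addr0.
    rewrite -H1 -H2; apply: eq_bigr => y _; rewrite ad_word_sum.
    congr (_ *: _); apply: eq_big_seq => w /S1 Sw.
    by rewrite dynkin_cat // /nilp Sw -lt0n.
  rewrite (sum_comm _ dynkin) (E _ _ _ _ _ n0 sz' adE dE').
  rewrite (E _ _ _ _ _ m0 sz adE' dE) (lieb_opp v u) scalerN opprK.
  by rewrite natrD scalerDl addrC.
- rewrite (sum_comm _ q) hL -qE -qE' lieb_sum.
  under [RHS]eq_bigr do under eq_bigr do rewrite qL scalerBr.
  under [RHS]eq_bigr do rewrite sumrB scalerBr.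
  rewrite sumrB; congr (_ - _).
  under [RHS]eq_bigr do rewrite scaler_sumr.
  rewrite exchange_big /=; apply: eq_bigr => y _; rewrite scaler_sumr.
  by apply: eq_bigr => x _; rewrite !scalerA mulrC.
Qed.

End Dynkin.

(** * Functions of the truncated free associative algebra *)

Section WordJets.
Variables (k : fieldType) (Z : finType) (c : nat).
Local Notation W := (c.-bseq Z).
Definition word_idx := jets_idx #|{: W}|.
Variables (J : comAlgType k) (X : word_idx -> J).
Hypothesis HX : is_polyalg X.
Local Notation q i := (X (inl i)).
Local Notation T al := (X (inr al)).
Local Notation d := (jet_der HX).

Definition idx_word (i : 'I_#|{: W}|) : seq Z := (enum_val i : W).

(** Sending long words to 0 amounts to dividing by the ideal that they span in the free associative
    algebra, which leaves finitely many coordinates. *)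
Definition word_var (w : seq Z) : J :=
  if insub w is Some b then q (enum_rank (b : W)) else 0.

Definition word_pi (i j : 'I_#|{: W}|) : J :=
  word_var (idx_word i ++ idx_word j) - word_var (idx_word j ++ idx_word i).

Lemma word_var_long w : (c < size w)%N -> word_var w = 0.
Proof. by rewrite /word_var; case: insubP => // b le _; rewrite ltnNge le. Qed.

Lemma word_varP w : (exists2 i, idx_word i = w & word_var w = q i) \/
  (c < size w)%N.
Proof.
have [le|] := leqP (size w) c; last by right.
left; exists (enum_rank (Bseq le)); first by rewrite /idx_word enum_rankK.
by rewrite /word_var (insubT (fun s => size s <= c)%N).
Qed.

(** Only the term of [w] itself survives; for a truncated [w] the left side is 0, whence the
    condition on [G]. *)
Lemma sum_der_word (G : seq Z -> J) w :
  (forall v, (c < size v)%N -> G v = 0) ->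
  \sum_s d s (word_var w) * G (idx_word s) = G w.
Proof.
move=> G0; have [[i iw ->]|lw] := word_varP w; last first.
  rewrite word_var_long // G0 //; apply: big1 => s _.
  by rewrite (der_0 (jet_derP HX s)) mul0r.
rewrite (bigD1 i) //= jet_der_pos eqxx mul1r iw big1 ?addr0 // => s /negPf si.
by rewrite jet_der_pos si mul0r.
Qed.

Lemma word_pi_alt i : word_pi i i = 0.
Proof. exact: subrr. Qed.

Lemma word_pi_anti i j : word_pi i j + word_pi j i = 0.
Proof. by rewrite /word_pi addrC subrKA subrr. Qed.

Lemma sum_der_word_pi i w : \sum_s d s (word_var w) * word_pi i s =
  word_var (idx_word i ++ w) - word_var (w ++ idx_word i).
Proof.
rewrite /word_pi (sum_der_word
  (G := fun v => word_var (idx_word i ++ v) - word_var (v ++ idx_word i))) //.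
move=> v lv; rewrite !word_var_long ?subrr // size_cat.
  exact: leq_trans lv (leq_addr _ _).
exact: leq_trans lv (leq_addl _ _).
Qed.

(** The Jacobi identity for commutators: associativity of concatenation turns everything into words
    of three blocks, which cancel. *)
Lemma word_pi_jacobi i j l :
  \sum_s d s (word_pi j l) * word_pi i s + \sum_s d s (word_pi l i) * word_pi j
    s
    + \sum_s d s (word_pi i j) * word_pi l s = 0.
Proof.
have E a b e : \sum_s d s (word_pi a b) * word_pi e s =
    (word_var (idx_word e ++ idx_word a ++ idx_word b)
     - word_var (idx_word a ++ idx_word b ++ idx_word e))
    - (word_var (idx_word e ++ idx_word b ++ idx_word a)
       - word_var (idx_word b ++ idx_word a ++ idx_word e)).
  under eq_bigr do rewrite [word_pi a b]/word_pi
    (der_add _ _ (jet_derP HX _)) (der_opp _ (jet_derP HX _)) mulrBl.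
  by rewrite sumrB !sum_der_word_pi -!catA.
rewrite !E; ring.
Qed.

(** An alias of [J] that remembers [HX], since the bracket is built from the derivations which [HX]
    provides. *)
Definition word_jets of is_polyalg X : Type := J.

Local Notation B := (word_jets HX).
HB.instance Definition _ := GRing.ComAlgebra.on B.

Definition word_br : J -> J -> J := bv_br d word_pi.

Let dP := jet_derP HX.
Let dC := jet_derC HX.
Let dq := jet_der_pos HX.

HB.instance Definition _ := Lmodule_isLie.Build k B
  (fun a x y z => der_linear (bv_derl word_pi dP z) a x y)
  (fun a x y z => der_linear (bv_derr dP word_pi_anti z) a x y)
  (bv_brxx d word_pi_alt word_pi_anti)
  (bv_jacobi dP dC dq word_pi_anti word_pi_jacobi).
HB.instance Definition _ := LieComAlgebra_isPoisson.Build k B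
  (fun x => der_mul (bv_derr dP word_pi_anti x)).

Lemma word_lieb_var (u v : seq Z) :
  lieb (word_var u : B) (word_var v) = word_var (u ++ v) - word_var (v ++ u).
Proof.
rewrite -[LHS]/(word_br (word_var u) (word_var v)) /word_br.
have [[i iu ->]|lu] := word_varP u.
  by rewrite (bv_brqE _ dq) sum_der_word_pi iu.
rewrite (word_var_long lu) (der_0 (bv_derl word_pi dP _)).
rewrite !word_var_long ?subrr // size_cat.
  exact: leq_trans lu (leq_addl _ _).
exact: leq_trans lu (leq_addr _ _).
Qed.

(** Each term of the bracket with [y] has some [d j y] as a factor. *)
Lemma killed_ideal (K : fieldType) (chi : {rmorphism J -> K}) :
  poisson_ideal (killed HX chi : set B).
Proof.
split=> [|a x y|x y|x y Ky].
- exact: killed_0.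
- exact: killed_lin.
- exact: killed_mul.
rewrite -[lieb x y]/(word_br x y) /word_br /bv_br.
apply: killed_sum => i; apply: killed_sum => j; rewrite mulrAC.
by apply: killed_mul; apply: killed_der.
Qed.

Lemma word_var_none w : polyvars X (@jets_none _) (word_var w).
Proof.
have [[i _ ->]|lw] := word_varP w; first exact: polyvarsX.
by rewrite word_var_long //; apply: subalg_0.
Qed.

Lemma jets_none_subalgebra :
  poisson_subalgebra (polyvars X (@jets_none _) : set B).
Proof.
split=> [|a x y|x y|x y Nx Ny].
- exact: subalg_1.
- exact: subalg_lin.
- exact: subalg_mul.
have der_none i z : polyvars X (@jets_none _) z ->
    polyvars X (@jets_none _) (d i z).
  apply: polyvars_der => [||[j|//] _] //; rewrite jet_der_pos.
  by case: (i == j); [exact: subalg_1 | exact: subalg_0].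
rewrite -[lieb x y]/(word_br x y) /word_br /bv_br.
apply: subalg_sum => i; apply: subalg_sum => j.
apply: subalg_mul; first by apply: subalg_mul; apply: der_none.
rewrite /word_pi -scaleN1r addrC.
by apply: subalg_lin; apply: word_var_none.
Qed.

Lemma content_surj n (al : multinom n) : exists w, content w = al.
Proof.
exists (flatten [seq nseq (al i) i | i <- enum 'I_n]).
apply/mnmP => j; rewrite mnmE count_flatten -map_comp sumnE big_map.
rewrite big_enum /= (bigD1 j) //= count_nseq /= eqxx mul1n big1 ?addn0 //.
by move=> i /negPf ij; rewrite count_nseq /= ij.
Qed.

Lemma jet_subst_exists (t : J) : exists phi : {rmorphism B -> B},
  [/\ poisson_hom phi, forall x, polyvars X (@jets_none _) x -> phi x = x
    & phi (T 0%MM) = t].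
Proof.
have [wd wdE] := choice (@content_surj #|{: W}|).
pose v (x : word_idx) : J := match x with
  | inl i => q i
  | inr al => jet_ders HX (wd al) t
  end.
pose phi : {rmorphism J -> J} := poly_ev HX (in_alg J) v.
have phiX x : phi (X x) = v x by exact: poly_evX.
have phiZ (a : k) x : phi (a *: x) = a *: phi x.
  by rewrite /phi poly_evZ /= mulr_algl.
clearbody phi.
have phid i x : phi (d i x) = d i (phi x).
  move: x; apply: (polyalg_gen HX) => [|[j|al]|a x y IHx IHy|x y IHx IHy].
  - by rewrite rmorph1 (der_1 (dP i)) rmorph0.
  - by rewrite phiX /= jet_der_pos; case: (i == j); rewrite ?rmorph1 ?rmorph0.
  - rewrite jet_der_jet !phiX /= -jet_ders_rcons; apply: jet_ders_perm.
    by apply: content_perm; rewrite content_rcons !wdE.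
  - by rewrite (der_linear (dP i)) !rmorphD !phiZ (der_linear (dP i)) IHx IHy.
  - by rewrite (der_mul (dP i)) rmorphD !rmorphM (der_mul (dP i)) IHx IHy.
have phi_id x : polyvars X (@jets_none _) x -> phi x = x.
  elim=> {x} [|x [[i|//] _ ->]|a x y _ IHx _ IHy|x y _ IHx _ IHy].
  - exact: rmorph1.
  - exact: phiX.
  - by rewrite rmorphD phiZ IHx IHy.
  - by rewrite rmorphM IHx IHy.
exists (phi : {rmorphism B -> B}); split=> //; last first.
  rewrite phiX /=; suff -> : wd 0%MM = [::] by [].
  case E: (wd 0%MM) => [//|i w]; have := wdE 0%MM; rewrite E.
  by move=> /(congr1 (fun al : multinom _ => al i)); rewrite !mnmE /= eqxx.
split=> [|x y]; first exact: phiZ.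
rewrite -[lieb x y]/(word_br x y) -[RHS]/(word_br (phi x) (phi y)) /word_br.
rewrite /bv_br rmorph_sum; apply: eq_bigr => i _.
rewrite rmorph_sum; apply: eq_bigr => j _.
have phi_pi : phi (word_pi i j) = word_pi i j.
  by rewrite /word_pi rmorphB !phi_id //; exact: word_var_none.
by rewrite !rmorphM phi_pi !phid.
Qed.

End WordJets.

(** * Recovering an element from its image *)

Section Recovery.
Variables (k : fieldType) (Z : finType) (F : poissonAlgType k).
Variable inj : free_lie k Z -> F.
Hypothesis char0 : forall n, n.+1%:R != 0 :> k.
Hypothesis injl :
  forall (a : k) u v, inj (a *: u + v) = a *: inj u + inj v.
Hypothesis injL : forall u v, inj (lieb u v) = lieb (inj u) (inj v).
Hypothesis inj_gen : generates inj.

Let inj0 : inj 0 = 0.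
Proof. by have := injl (-1) 0 0; rewrite scaler0 addr0 scaleN1r addNr. Qed.

Section FixedDegree.
Variables (c : nat) (J : comAlgType k) (X : word_idx Z c -> J).
Hypothesis HX : is_polyalg X.
Local Notation B := (word_jets HX).

(** Only an algebra morphism, meant as a left inverse of the map sending each generator to its
    one-letter word. *)
Definition word_rec : {rmorphism J -> F} :=
  poly_ev HX (in_alg F) (fun x =>
    match x with
    | inl i => inj ((size (idx_word i))%:R^-1 *: dynkin k (idx_word i))
    | inr _ => 0
    end).

Lemma word_recZ (a : k) x : word_rec (a *: x) = a *: word_rec x.
Proof. by rewrite /word_rec poly_evZ /= mulr_algl. Qed.

Lemma word_rec_var w : (size w <= c)%N ->
  word_rec (word_var X w) = inj ((size w)%:R^-1 *: dynkin k w).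
Proof.
move=> lw; have [[i iw ->]|] := word_varP X w; last by rewrite ltnNge lw.
by rewrite /word_rec poly_evX iw.
Qed.

(** The words in the expansion of [v] all have length [n], so the Dynkin map multiplies [v] by [n]
    and the normalisation divides by it. The bound on [n] keeps these words from being truncated. *)
Lemma word_rec_monomial (phi : {rmorphism F -> B}) n v :
  poisson_hom phi -> (forall x, phi (inj (fl_gen k x)) = word_var X [:: x]) ->
  lie_monomial n v -> (n <= c)%N -> word_rec (phi (inj v)) = inj v.
Proof.
move=> [phiZ phiL] phiX Mv nc.
have [u w|//|u w|s [sz _ dE hE]] :=
  @lie_monomial_words k Z B (phi \o inj) (word_var X) _ _ _ n v Mv.
- by rewrite /= injL phiL.
- exact: (word_lieb_var HX).
have n0 : n%:R != 0 :> k.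
  by case: (n) (lie_monomial_gt0 Mv) => // p _; apply: char0.
rewrite -[phi (inj v)]hE.
have -> : v = n%:R^-1 *: (\sum_(p <- s) p.1 *: dynkin k p.2).
  by rewrite dE scalerA mulVf // scale1r.
elim: s sz {dE hE} => [|p s IH] sz.
  by rewrite !big_nil scaler0 inj0; apply: (rmorph0 word_rec).
have sp : size p.2 = n by apply: sz; rewrite inE eqxx.
have {}IH := IH (fun p' ps => sz p' (mem_behead (s := p :: s) ps)).
rewrite !big_cons scalerDr scalerA mulrC -scalerA injl -IH -sp.
rewrite -word_rec_var ?sp // -word_recZ; exact: (rmorphD word_rec).
Qed.

End FixedDegree.

(** The bound [c0] comes from the degrees of the bracket monomials used to build [f]. It is chosen
    before [c], so that several elements can share one truncation. *)
Lemma word_rec_large f : exists c0, forall c (J : comAlgType k)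
    (X : word_idx Z c -> J) (HX : is_polyalg X)
    (phi : {rmorphism F -> word_jets HX}),
  (c0 <= c)%N -> poisson_hom phi ->
  (forall x, phi (inj (fl_gen k x)) = word_var X [:: x]) ->
  word_rec HX (phi f) = f.
Proof.
move: f; apply: inj_gen => [|v|a x y [cx Hx] [cy Hy]|x y [cx Hx] [cy Hy]].
- exists 0 => c J X HX phi _ _ _; rewrite rmorph1;
    exact: (rmorph1 (word_rec HX)).
- move: v; apply: lie_monomial_span_ind => [n v Mv||a u v [cu Hu] [cv Hv]].
  + exists n => c J X HX phi nc Hphi phiX;
      exact: word_rec_monomial Hphi phiX Mv nc.
  + exists 0 => c J X HX phi _ _ _; rewrite inj0 rmorph0.
    exact: (rmorph0 (word_rec HX)).
  + exists (maxn cu cv) => c J X HX phi;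
      rewrite geq_max => /andP [uc vc] Hp HpX.
    rewrite injl rmorphD (phom_scale Hp).
    apply: etrans (rmorphD (word_rec HX) _ _) _.
    by rewrite word_recZ Hu // Hv.
- exists (maxn cx cy) => c J X HX phi; rewrite geq_max => /andP [xc yc] Hp HpX.
  rewrite rmorphD (phom_scale Hp).
  apply: etrans (rmorphD (word_rec HX) _ _) _.
  by rewrite word_recZ Hx // Hy.
- exists (maxn cx cy) => c J X HX phi; rewrite geq_max => /andP [xc yc] Hp HpX.
  rewrite rmorphM; apply: etrans (rmorphM (word_rec HX) _ _) _.
  by rewrite Hx // Hy.
Qed.

End Recovery.

(** * The Freiheitssatz *)

Section Freiheitssatz.
Variables (k : fieldType) (Z : finType) (e : linear_basis (free_lie k Z)).
Variable l : Z.
Local Notation F := (free_poisson e).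
Hypothesis char0 : forall n, n.+1%:R != 0 :> k.
Let S : set Z := [set x | x != l].
Local Notation A := (fp_subalgebra e S).

Lemma fp_subalgebra_gen x : x != l -> A (fp_gen e x).
Proof. by move=> xl; apply: subalgebra_gen_in; exists x. Qed.

Lemma fp_retraction : exists pi : {rmorphism F -> F},
  [/\ poisson_hom pi, forall f, A (pi f)
    & forall x, pi (fp_gen e x) = if x == l then 0 else fp_gen e x].
Proof.
have [pi Hpi piX] := @fp_ev_exists k Z e F
  (fun x => if x == l then 0 else fp_gen e x).
exists pi; split=> // f.
have HA : poisson_subalgebra A := subalgebra_gen_poisson _.
apply: (subalgebra_gen_ind (phom_subalgebra Hpi HA) _ (fp_generated f)).
move=> _ [x _ <-] /=; rewrite piX; case: eqVneq => [_|].
  exact: psub_0.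
exact: fp_subalgebra_gen.
Qed.

Lemma fp_generates_inj : generates (sp_inj e : free_lie k Z -> F).
Proof.
move=> Q Q1 QI Ql QM; apply: (@poly_generates k (basis_idx e)) => // i.
by rewrite fp_var.
Qed.

Lemma fp_recover f : exists c0, forall c (J : comAlgType k)
    (X : word_idx Z c -> J) (HX : is_polyalg X)
    (phi : {rmorphism F -> word_jets HX}),
  (c0 <= c)%N -> poisson_hom phi ->
  (forall x, phi (fp_gen e x) = word_var X [:: x]) -> phi f = 0 -> f = 0.
Proof.
have [a u v|u v|c0 H] :=
  @word_rec_large k Z F (sp_inj e) char0 _ _ fp_generates_inj f.
- exact: sp_inj_linear.
- exact: sp_inj_lieb.
exists c0 => c J X HX phi cc Hphi phiX E.
have := H c J X HX phi cc Hphi phiX; rewrite E => <-.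
exact: (rmorph0 (word_rec _ HX)).
Qed.

Lemma freiheitssatz f h : ~ A f -> ideal_gen f h -> A h -> h = 0.
Proof.
move=> fN hI hA; have [pi [Hpi piA piX]] := fp_retraction.
have [c1 rec1] := fp_recover h; have [c2 rec2] := fp_recover (f - pi f).
pose c := maxn c1 c2.
have [J [X HX]] : exists (J : comAlgType k) (X : word_idx Z c -> J),
    is_polyalg X.
  by exists (polyalg k (word_idx Z c)), (@poly_var _ _); apply: polyalgP.
have {}rec1 := rec1 c J X HX ^~ (leq_maxl _ _).
have {}rec2 := rec2 c J X HX ^~ (leq_maxr _ _).
pose B : poissonAlgType k := word_jets HX.
have [phi Hphi phiX] := @fp_ev_exists k Z e B
  (fun x => if x == l then X (inr 0%MM) else word_var X [:: x]).
have [psi Hpsi psiX] := @fp_ev_exists k Z e B (fun x => word_var X [:: x]).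
have phi_psi g : A g -> phi g = psi g.
  apply: (subalgebra_gen_ind (phom_eq_subalgebra Hphi Hpsi)) => _ [x xl <-] /=.
  by rewrite phiX psiX; move: xl; rewrite /S /= => /negPf ->.
have phi_none g : A g -> polyvars X (@jets_none _) (phi g).
  apply: (subalgebra_gen_ind
    (phom_subalgebra Hphi (jets_none_subalgebra HX))) => _ [x xl <-] /=.
  rewrite phiX; move: xl; rewrite /S /= => /negPf ->; exact: word_var_none.
(* If the unknown were absent from [phi f], substituting the coordinate of [l] or 0 for it would
   change nothing. The first substitution yields [psi f], the second [psi (pi f)]; so [psi] kills
   [f - pi f], and recovery gives [f = pi f]. *)
have phi_f : ~ polyvars X (@jets_none _) (phi f).
  move=> Nf; apply: fN; suff -> : f = pi f by exact: piA.
  apply/eqP; rewrite -subr_eq0; apply/eqP.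
  apply: (rec2 psi Hpsi psiX); rewrite rmorphB; apply/eqP; rewrite subr_eq0.
  have [s [Hs s_id sT]] := jet_subst_exists HX (word_var X [:: l]).
  have [t [Ht t_id tT]] := jet_subst_exists HX 0.
  have Es : s \o phi =1 psi.
    apply: (fp_hom_eq (phom_comp Hs Hphi) Hpsi) => x /=; rewrite phiX psiX.
    by case: eqVneq => [->|_]; [exact: sT | apply: s_id; exact: word_var_none].
  have Et : t \o phi =1 psi \o pi.
    apply: (fp_hom_eq (phom_comp Ht Hphi) (phom_comp Hpsi Hpi)) => x /=.
    rewrite phiX piX; case: eqVneq => [_|_].
      by rewrite rmorph0; exact: tT.
    rewrite psiX; apply: t_id; exact: word_var_none.
  by rewrite -Es -[psi (pi f)]Et /= s_id // t_id.
apply: contrapT => /eqP h0.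
have [|K [chi [kf gh]]] := jets_zero HX char0 phi_f (phi_none _ hA).
  rewrite (phi_psi _ hA); apply: contraNneq h0 => E.
  by rewrite (rec1 psi Hpsi psiX E).
(* The empty word turns killing of [phi h] into [chi (phi h) = 0]. The preimage under [phi] of the
   killed elements is a Poisson ideal containing [f], hence [h]. *)
suff kh : killed HX chi (phi h) by rewrite (kh [::]) eqxx in gh.
have [I0 Il IM IL] := killed_ideal HX chi.
apply: (ideal_gen_ind (J := [set x | killed HX chi (phi x)]) _ kf hI).
split=> /= [|a x y Kx Ky|x y Ky|x y Ky].
- rewrite rmorph0; exact: I0.
- rewrite rmorphD (phom_scale Hphi); exact: Il.
- rewrite rmorphM; exact: IM.
- rewrite (phom_lieb Hphi); exact: IL.
Qed.

End Freiheitssatz.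

Theorem theorem2 (k : fieldType) (k_char0 : [pchar k] =i pred0)
    (m : nat) (m_gt0 : (0 < m)%N)
    (e : linear_basis (free_lie k 'I_m)) (f : free_poisson e)
    (fN : ~ fp_subalgebra e [set i : 'I_m | (i.+1 < m)%N] f) :
  ideal_gen f `&` fp_subalgebra e [set i : 'I_m | (i.+1 < m)%N] = [set 0].
Proof.
have lm : (m.-1 < m)%N by rewrite prednK.
have SE : [set i : 'I_m | (i.+1 < m)%N] = [set i : 'I_m | i != Ordinal lm].
  have E p (i : 'I_p) : (i.+1 < p)%N = (i != p.-1 :> nat).
    by case: p i => [[]|p [i ip]] //=; rewrite ltnS ltn_neqAle -ltnS ip andbT.
  by apply/seteqP; split=> i /=; rewrite E.
have char0 n : n.+1%:R != 0 :> k by have /pcharf0P -> := k_char0.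
rewrite SE in fN *; apply/seteqP; split=> h.
  by move=> [hI hA]; apply: freiheitssatz fN hI hA.
move=> /= ->; split; last exact: (psub_0 (subalgebra_gen_poisson _)).
by move=> J [[J0 _ _ _] _].
Qed.
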